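(* For real-valued $c$ such that $M_c(\tau)$ is irreducible and unitarisable, the standard module has the following joint $(\mathcal V,\mathfrak u(1,1))$-decomposition: $$M_c(\tau)=\bigoplus_{k\in\mathbb Z_{\ge0}}\ \bigoplus_{\lambda\in\Sigma_c(\tau)_k}\mathcal H_c(\tau)_{k,\lambda}\otimes L_{\mathfrak u(1,1)}(k+n-N_c(\tau),\lambda),$$ where $L_{\mathfrak u(1,1)}(\mu,\nu)$ denotes the irreducible lowest weight $\mathfrak u(1,1)$-representation of $(H,Z_0)$-lowest weight $(\mu,\nu)$.
   Context: $E$ is a real vector space of dimension $2n$ with a positive definite symmetric bilinear form $B$; $\langle\cdot,\cdot\rangle$ is the pairing $E^*\times E\to\mathbb R$. $G$ is a finite reflection group acting on $E$ by orthogonal transformations, $\mathcal S$ its set of reflections. For $s\in\mathcal S$, $\alpha_s\in E$, $a_s\in E^*$ are fixed $(-1)$-eigenvectors of $s$ and $\alpha_s^\vee=2a_s/\langle a_s,\alpha_s\rangle$. $c$ is a conjugation-invariant function on $\mathcal S$. $H_c(G,E)$ is the quotient of $T(E_{\mathbb C}\oplus E_{\mathbb C}^* )\rtimes G$ (where $gX=(g\cdot X)g$) by $[\xi,\eta]=0$ ($\xi,\eta\in E$), $[x,y]=0$ ($x,y\in E^*$), $[\xi,x]=\langle x,\xi\rangle-\sum_{s\in\mathcal S}\langle x,\alpha_s\rangle\langle\alpha_s^\vee,\xi\rangle c(s)s$. A complex structure $J\in\mathrm{SO}(E,B)$, $J^T=-J$, is fixed, with orthonormal basis $\xi_1,\dots,\xi_n,\eta_1,\dots,\eta_n$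 of $E$ such that $J\xi_j=-\eta_j$, $J\eta_j=\xi_j$, and dual basis $x_1,\dots,x_n,y_1,\dots,y_n$ of $E^*$. Set $E_+=\frac12\sum_j(x_j^2+y_j^2)$, $E_-=-\frac12\sum_j(\xi_j^2+\eta_j^2)$, $H=\sum_j(x_j\xi_j+y_j\eta_j)+n-\sum_{s}c(s)s$, $Z_0=i\sum_j(x_j\eta_j-y_j\xi_j)$. The elements $E_+,E_-,H$ span a copy of $\mathfrak{su}(1,1)$ ($[H,E_\pm]=\pm2E_\pm$, $[E_+,E_-]=H$), and together with $Z_0$, which commutes with them, a copy of $\mathfrak u(1,1)$ inside $H_c(G,E)$. $\mathcal V$ is the centraliser algebra of this $\mathfrak u(1,1)$ in $H_c(G,E)$. For an irreducible $\mathbb C[G]$-module $\tau$ on $V(\tau)$, $M_c(\tau)\cong\mathbb C[E]\otimes V(\tau)$ is the standard module of $H_c(G,E)$, induced from $V(\tau)$ with $E$ acting on $V(\tau)$ by zero; $M_c(\tau)_k$ is its polynomial degree-$k$ part; $N_c(\tau)$ is the scalar by which $\sum_sc(s)s$ acts on $V(\tau)$. $\mathcal H_c(\tau)_k=M_c(\tau)_k\cap\ker E_-$, $\Sigma_c(\tau)_k$ is the set of eigenvalues of $Z_0$ on $\mathcal H_c(\tau)_k$, and $\mathcal H_c(\tau)_{k,\lambda}$ the $\lambda$-eigenspace of $Z_0$ in $\mathcal H_c(\tau)_k$. For real $c$, $\ast$ is the conjugate-linear anti-involution of $H_c(G,E)$ with $\xi_j^*=x_j$, $x_j^*=\xi_j$,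 $\eta_j^*=y_j$, $y_j^*=\eta_j$, $s^*=s$; $M_c(\tau)$ carries a Hermitian form $\beta$ with $\beta(hp,q)=\beta(p,h^*q)$ restricting to a $G$-invariant inner product on $V(\tau)$, and is called unitarisable if $\beta$ is positive definite. A lowest weight vector of lowest weight $(\mu,\nu)$ is annihilated by $E_-$ and has $H$-, $Z_0$-eigenvalues $\mu,\nu$. *)

(* Defs.v *)
From HB Require Import structures.
From mathcomp Require Import all_boot all_order all_algebra all_fingroup.
From mathcomp Require Import finmap boolp classical_sets reals.
From mathcomp Require Import complex.
From mathcomp Require Import monalg ring.

Set Implicit Arguments.
Unset Strict Implicit.
Unset Printing Implicit Defensive.

Import GRing.Theory Num.Theory.
Local Open Scope ring_scope.
Local Open Scope complex_scope.
Local Open Scope quotient_scope.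

Section Span.
Context {K : pzRingType} {V : lmodType K}.

(* The submodule spanned by S. *)
Definition lspan (S : set V) : {pred V} :=
  fun v => `[< forall U : submodClosed V, (forall u, S u -> u \in U) -> v \in U >].

Lemma lspan_closed (S : set V) : submod_closed (lspan S).
Proof.
split; first by apply/asboolP => U _; exact: rpred0.
move=> a u v /asboolP Su /asboolP Sv; apply/asboolP => U SU.
by rewrite rpredD ?rpredZ ?Su ?Sv.
Qed.

HB.instance Definition _ (S : set V) :=
  GRing.isSubmodClosed.Build K V (lspan S) (lspan_closed S).

Lemma mem_lspan (S : set V) v : S v -> v \in lspan S.
Proof. by move=> Sv; apply/asboolP => U; apply. Qed.

Lemma lspan_sub (S : set V) (U : submodClosed V) :
  (forall u, S u -> u \in U) -> {subset lspan S <= U}.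
Proof. by move=> SU v /asboolP; apply. Qed.

End Span.

Lemma lspan_ind (K : pzRingType) (V : lmodType K) (S : set V) (P : V -> Prop) :
  P 0 -> (forall a u v, P u -> P v -> P (a *: u + v)) ->
  (forall u, S u -> P u) -> forall u, u \in lspan S -> P u.
Proof.
move=> P0 PD SP; pose T : {pred V} := fun u => `[< P u >].
have TC : submod_closed T.
  split; first exact/asboolP.
  by move=> a u v /asboolP Pu /asboolP Pv; apply/asboolP/PD.
pose TS := HB.pack_for (submodClosed V) T (GRing.isSubmodClosed.Build K V T TC).
by move=> u uS; apply/asboolP; apply: (lspan_sub (U := TS) _ uS) => v /SP /asboolP.
Qed.

Lemma lspan_ker (K : pzRingType) (V W : lmodType K) (S : set V)
  (f : {linear V -> W}) : (forall u, S u -> f u = 0) ->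
  forall u, u \in lspan S -> f u = 0.
Proof.
move=> f0; apply: lspan_ind => //; first exact: linear0.
by move=> a u v fu fv; rewrite linearP fu fv scaler0 addr0.
Qed.

Section Subspace.
Context {K : pzRingType} {V : lmodType K} (U : submodClosed V).

Record subspace := Subspace {
  subspace_val : V;
  subspace_valP : subspace_val \in (U : {pred V}) }.

HB.instance Definition _ := [isSub for subspace_val].
HB.instance Definition _ := [Choice of subspace by <:].
HB.instance Definition _ := [SubChoice_isSubLmodule of subspace by <:].

End Subspace.

Section QuotientModule.
Context {K : pzRingType} {V : lmodType K} (S : set V).

Definition qmod := Quotient.quot (lspan S).
HB.instance Definition _ := GRing.Zmodule.on qmod.

Definition qpi (v : V) : qmod := \pi_(Quotient.quot (lspan S)) v.
Definition qrepr (x : qmod) : V := generic_quotient.repr (x : Quotient.quot (lspan S)).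

Lemma qreprK x : qpi (qrepr x) = x. Proof. exact: reprK. Qed.

Lemma qpi_eq v w : qpi v = qpi w <-> v - w \in lspan S.
Proof. by rewrite (Quotient.idealrBE (lspan S)); split=> [/eqP|/eqP]. Qed.

Lemma qpi_zmod : zmod_morphism qpi.
Proof. exact: pi_is_zmod_morphism. Qed.

Definition qscale (a : K) (x : qmod) : qmod := qpi (a *: qrepr x).

Lemma qscale_pi a v : qscale a (qpi v) = qpi (a *: v).
Proof. by apply/qpi_eq; rewrite -scalerBr rpredZ//; apply/qpi_eq/qreprK. Qed.

Lemma qpiD v w : qpi v + qpi w = qpi (v + w).
Proof.
have q0 : qpi 0 = 0 by have := qpi_zmod 0 0; rewrite !subrr.
have qN u : qpi (- u) = - qpi u by have := qpi_zmod 0 u; rewrite q0 !sub0r.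
by rewrite -[w in RHS]opprK qpi_zmod qN opprK.
Qed.

Lemma qscaleA a b x : qscale a (qscale b x) = qscale (a * b) x.
Proof. by rewrite -[x]qreprK !qscale_pi scalerA. Qed.
Lemma qscale1 x : qscale 1 x = x.
Proof. by rewrite -[x]qreprK qscale_pi scale1r. Qed.
Lemma qscaleDr a : {morph qscale a : x y / x + y}.
Proof.
by move=> x y; rewrite -[x]qreprK -[y]qreprK qpiD !qscale_pi qpiD scalerDr.
Qed.
Lemma qscaleDl x : {morph qscale^~ x : a b / a + b}.
Proof. by move=> a b; rewrite -[x]qreprK !qscale_pi qpiD scalerDl. Qed.

HB.instance Definition _ :=
  GRing.Zmodule_isLmodule.Build K qmod qscaleA qscale1 qscaleDr qscaleDl.

Lemma qpi_linear : linear qpi.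
Proof. by move=> a u v; rewrite -qpiD -qscale_pi. Qed.
HB.instance Definition _ := GRing.isLinear.Build K V qmod _ qpi qpi_linear.

Lemma qpi_eq0 v : S v -> qpi v = 0.
Proof. by move=> Sv; rewrite -(raddf0 qpi); apply/qpi_eq; rewrite subr0 mem_lspan. Qed.

Definition qlift {W : lmodType K} (f : V -> W) (x : qmod) : W := f (qrepr x).

Section Lift.
Context {W : lmodType K} (f : {linear V -> W}).
Hypothesis f0 : forall v, S v -> f v = 0.

Lemma qlift_pi v : qlift f (qpi v) = f v.
Proof.
apply/eqP; rewrite -subr_eq0 /qlift -raddfB; apply/eqP/(lspan_ker f0).
by apply/qpi_eq/qreprK.
Qed.

Lemma qlift_linear : linear (qlift f).
Proof.
by move=> a x y; rewrite -[x]qreprK -[y]qreprK -linearP !qlift_pi linearP.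
Qed.
End Lift.

End QuotientModule.

Arguments qpi {K V} S v.

Section FreeModule.
Context {K : nzRingType} {X : choiceType} {W : lmodType K} (f : X -> W).

Definition flift (p : {malg K[X]}) : W := \sum_(x <- msupp p) p@_x *: f x.

Lemma flift_sub (d : {fset X}) (p : {malg K[X]}) :
  (msupp p `<=` d)%fset -> flift p = \sum_(x <- d) p@_x *: f x.
Proof.
move=> pd; rewrite /flift (big_fset_incl _ pd)//= => x _ /mcoeff_outdom ->.
by rewrite scale0r.
Qed.

Lemma flift_linear : linear flift.
Proof.
move=> a p q; pose d := (msupp p `|` msupp q `|` msupp (a *: p + q))%fset.
rewrite (@flift_sub d p) 1?(@flift_sub d q) 1?(@flift_sub d (a *: p + q)).
- rewrite scaler_sumr -big_split/=; apply: eq_bigr => x _.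
  by rewrite mcoeffD mcoeffZ scalerDl scalerA.
- by rewrite /d fsubsetUr.
- by rewrite /d -fsetUA fsubsetU// fsubsetUl orbT.
- by rewrite /d -fsetUA fsubsetUl.
Qed.
HB.instance Definition _ := GRing.isLinear.Build K {malg K[X]} W _ flift flift_linear.

Lemma fliftU x : flift << x >> = f x.
Proof.
by rewrite (@flift_sub [fset x]%fset) ?msuppU_le// big_seq_fset1 mcoeffUU scale1r.
Qed.

End FreeModule.

Section Tensor.
Context {K : nzRingType} {U W : lmodType K}.

Inductive tensor_rel : {malg K[(U * W)%type]} -> Prop :=
| TensorRelL a u u' w :
    tensor_rel (<< (a *: u + u', w) >> - (a *: << (u, w) >> + << (u', w) >>))
| TensorRelR a u w w' :
    tensor_rel (<< (u, a *: w + w') >> - (a *: << (u, w) >> + << (u, w') >>)).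

Definition tensor : lmodType K := qmod tensor_rel.

Definition tens (u : U) (w : W) : tensor := qpi tensor_rel << (u, w) >>.

Lemma tensPl a u u' w : tens (a *: u + u') w = a *: tens u w + tens u' w.
Proof.
apply/eqP; rewrite -subr_eq0 /tens -linearP -raddfB; apply/eqP/qpi_eq0.
exact: TensorRelL.
Qed.

Lemma tensPr a u w w' : tens u (a *: w + w') = a *: tens u w + tens u w'.
Proof.
apply/eqP; rewrite -subr_eq0 /tens -linearP -raddfB; apply/eqP/qpi_eq0.
exact: TensorRelR.
Qed.

Section Lift.
Context {P : lmodType K} (b : U -> W -> P).
Hypothesis bPl : forall w, linear (b^~ w).
Hypothesis bPr : forall u, linear (b u).

Definition tlift : tensor -> P := qlift (flift (fun x : U * W => b x.1 x.2)).

Lemma tlift_ker p : tensor_rel p -> flift (fun x : U * W => b x.1 x.2) p = 0.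
Proof.
by case=> a u w1 w2; rewrite linearB/= linearP/= !fliftU/= ?bPl ?bPr subrr.
Qed.

Lemma tliftE u w : tlift (tens u w) = b u w.
Proof. rewrite /tlift qlift_pi => [|p]; last exact: tlift_ker.
by rewrite /= fliftU.
Qed.

Lemma tlift_linear : linear tlift.
Proof. apply: qlift_linear; exact: tlift_ker. Qed.
End Lift.

End Tensor.
Arguments tensor {K} U W.

Section DirectSum.
Context {K : nzRingType} {I : choiceType} (A : I -> lmodType K).

Inductive dsum_rel : {malg K[{i : I & A i}]} -> Prop :=
| DsumRel i a (u v : A i) :
    dsum_rel (<< Tagged A (a *: u + v) >>
              - (a *: << Tagged A u >> + << Tagged A v >>)).

Definition dsum : lmodType K := qmod dsum_rel.

Definition din (i : I) (u : A i) : dsum := qpi dsum_rel << Tagged A u >>.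

Lemma din_linear i : linear (@din i).
Proof.
move=> a u v; apply/eqP; rewrite -subr_eq0 /din -linearP -raddfB.
by apply/eqP/qpi_eq0; exact: DsumRel.
Qed.
HB.instance Definition _ i := GRing.isLinear.Build K (A i) dsum _ (@din i) (@din_linear i).

End DirectSum.
Arguments din {K I} A i u.

Lemma malg_scalerAr (K : comNzRingType) (M : monomType) a (p q : {malg K[M]}) :
  a *: (p * q) = p * (a *: q).
Proof.
rewrite -[a *: q]mul_malgC mulrA -[a *: (p * q)]mul_malgC mulrA; congr (_ * _).
rewrite [RHS]fgmulgU [LHS]fgmulUg; apply: eq_bigr => k _.
by rewrite mul1m mulm1 mulrC.
Qed.

Section FreeAlgebra.
Context (K : comNzRingType) (X : choiceType).

Definition free_alg := {malg K[{fmonom X}]}.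
HB.instance Definition _ := GRing.Lalgebra.on free_alg.

HB.instance Definition _ := GRing.Lalgebra_isAlgebra.Build K free_alg
  (@malg_scalerAr K {fmonom X}).

Definition free_gen (x : X) : free_alg := << fmu x >>.

End FreeAlgebra.

Section QuotientAlgebra.
Context {K : comNzRingType} {A : algType K} (S : set A).

Definition two_sided : set A :=
  fun u => exists p r q, S r /\ u = p * r * q.

(* The quotient of A by the two-sided ideal generated by S. It may be trivial,
   hence only carries a pzRingType (and not an algType) structure. *)
Definition qalg := qmod two_sided.
HB.instance Definition _ := GRing.Lmodule.on qalg.

Lemma two_sided_closed p q u :
  u \in lspan two_sided -> p * u * q \in lspan two_sided.
Proof.
move: u; apply: lspan_ind.
- by rewrite mulr0 mul0r rpred0.
- move=> a u v uI vI; rewrite mulrDr mulrDl -scalerAr -scalerAl.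
  by have [_ ->] := lspan_closed two_sided.
- move=> u [p' [r [q' [Sr ->]]]]; apply: mem_lspan.
  by exists (p * p'), r, (q' * q); rewrite !mulrA.
Qed.

Definition qalg_one : qalg := qpi two_sided 1.
Definition qalg_mul (x y : qalg) : qalg := qpi two_sided (qrepr x * qrepr y).

Lemma qalg_mul_pi u v :
  qalg_mul (qpi two_sided u) (qpi two_sided v) = qpi two_sided (u * v).
Proof.
apply/qpi_eq.
set u' := qrepr _; set v' := qrepr _.
have uI : u' - u \in lspan two_sided by apply/qpi_eq/qreprK.
have vI : v' - v \in lspan two_sided by apply/qpi_eq/qreprK.
have -> : u' * v' - u * v = 1 * (u' - u) * v' + u * (v' - v) * 1.
  by rewrite mul1r mulr1 mulrBl mulrBr addrA subrK.
by apply: rpredD; exact: two_sided_closed.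
Qed.

Lemma qalg_mulA : associative qalg_mul.
Proof.
by move=> x y z; rewrite -[x]qreprK -[y]qreprK -[z]qreprK !qalg_mul_pi mulrA.
Qed.
Lemma qalg_mul1 : left_id qalg_one qalg_mul.
Proof. by move=> x; rewrite -[x]qreprK qalg_mul_pi mul1r. Qed.
Lemma qalg_mulr1 : right_id qalg_one qalg_mul.
Proof. by move=> x; rewrite -[x]qreprK qalg_mul_pi mulr1. Qed.
Lemma qalg_mulDl : left_distributive qalg_mul +%R.
Proof.
move=> x y z; rewrite -[x]qreprK -[y]qreprK -[z]qreprK.
by rewrite qpiD !qalg_mul_pi qpiD mulrDl.
Qed.
Lemma qalg_mulDr : right_distributive qalg_mul +%R.
Proof.
move=> x y z; rewrite -[x]qreprK -[y]qreprK -[z]qreprK.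
by rewrite qpiD !qalg_mul_pi qpiD mulrDr.
Qed.

HB.instance Definition _ := GRing.Zmodule_isPzRing.Build qalg
  qalg_mulA qalg_mul1 qalg_mulr1 qalg_mulDl qalg_mulDr.

Lemma qpi_alg1 : qpi two_sided 1 = 1 :> qalg. Proof. by []. Qed.

Lemma qpi_algM u v :
  qpi two_sided (u * v) = (qpi two_sided u : qalg) * qpi two_sided v.
Proof. by rewrite -qalg_mul_pi. Qed.

Lemma qalg_scalerAl a (x y : qalg) : a *: (x * y) = (a *: x) * y.
Proof.
rewrite -[x]qreprK -[y]qreprK -qpi_algM -[a *: qpi _ (qrepr x)]linearZ/=.
by rewrite -qpi_algM -scalerAl -linearZ.
Qed.

Lemma qalg_scalerAr a (x y : qalg) : a *: (x * y) = x * (a *: y).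
Proof.
rewrite -[x]qreprK -[y]qreprK -qpi_algM -[a *: qpi _ (qrepr y)]linearZ/=.
by rewrite -qpi_algM -scalerAr -linearZ.
Qed.

End QuotientAlgebra.

(* Complex representations of u(1,1), i.e. of its complexification gl_2, which
   has basis E_+, E_-, H, Z_0 with Z_0 central. *)
Record u11_module (K : numFieldType) := U11Module {
  u11_sort :> lmodType K;
  u11_Ep : {linear u11_sort -> u11_sort};
  u11_Em : {linear u11_sort -> u11_sort};
  u11_H : {linear u11_sort -> u11_sort};
  u11_Z : {linear u11_sort -> u11_sort};
  u11_HEp : forall v, u11_H (u11_Ep v) - u11_Ep (u11_H v) = 2 *: u11_Ep v;
  u11_HEm : forall v, u11_H (u11_Em v) - u11_Em (u11_H v) = - 2 *: u11_Em v;
  u11_EpEm : forall v, u11_Ep (u11_Em v) - u11_Em (u11_Ep v) = u11_H v;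
  u11_ZEp : forall v, u11_Z (u11_Ep v) = u11_Ep (u11_Z v);
  u11_ZEm : forall v, u11_Z (u11_Em v) = u11_Em (u11_Z v);
  u11_ZH : forall v, u11_Z (u11_H v) = u11_H (u11_Z v)
}.

Definition u11_irreducible (K : numFieldType) (L : u11_module K) : Prop :=
  (exists v : L, v != 0) /\
  forall U : submodClosed L,
    (forall v, v \in U -> [/\ u11_Ep L v \in U, u11_Em L v \in U,
                              u11_H L v \in U & u11_Z L v \in U]) ->
    (forall v, v \in U -> v = 0) \/ (forall v, v \in U).

Definition u11_lowest_weight (K : numFieldType) (L : u11_module K) (mu nu : K)
    (v : L) : Prop :=
  [/\ v != 0, u11_Em L v = 0, u11_H L v = mu *: v & u11_Z L v = nu *: v].

Definition u11_irr_lowest_weight (K : numFieldType) (mu nu : K)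
    (L : u11_module K) : Prop :=
  u11_irreducible L /\ exists v : L, u11_lowest_weight mu nu v.

(* A model of the irreducible module of lowest weight (mu, nu): 'X^i stands for
   E_+ ^ i applied to the lowest weight vector, with the exponents at which
   these vectors vanish removed. *)
Section LowestWeightModel.
Context (K : numFieldType) (mu nu : K).

Definition lw_null (i : nat) : bool := [exists j : 'I_i, mu + j%:R == 0].

Lemma lw_nullS i : lw_null i -> lw_null i.+1.
Proof. by case/existsP => j h; apply/existsP; exists (widen_ord (leqnSn i) j). Qed.

Lemma lw_nullP i : mu + i%:R = 0 -> lw_null i.+1.
Proof. by move=> h; apply/existsP; exists ord_max; rewrite /= h. Qed.

Lemma lw_nullSE i : lw_null i.+1 -> ~~ lw_null i -> mu + i%:R = 0.
Proof.
case/existsP => j hj /existsPn h; move: (ltn_ord j); rewrite ltnS leq_eqVlt.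
case/orP => [/eqP <-|ji]; first exact/eqP.
by have := h (Ordinal ji); rewrite /= hj.
Qed.

Definition lw_pred : {pred {poly K}} :=
  fun p => `[< forall i, lw_null i -> p`_i = 0 >].

Lemma lw_pred_closed : submod_closed lw_pred.
Proof.
split; first by apply/asboolP => i _; rewrite coef0.
move=> a p q /asboolP hp /asboolP hq; apply/asboolP => i hi.
by rewrite coefD coefZ hp ?hq// mulr0 addr0.
Qed.
HB.instance Definition _ :=
  GRing.isSubmodClosed.Build K {poly K} lw_pred lw_pred_closed.

Let L := subspace lw_pred.

Lemma lw_coef0 (p : L) i : lw_null i -> (val p)`_i = 0.
Proof. by case: p => p /= /asboolP; apply. Qed.

Lemma lw_eq (p q : L) : (forall i, (val p)`_i = (val q)`_i) -> p = q.
Proof. by move=> h; apply/val_inj/polyP. Qed.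

Lemma lwPE a (p q : L) i :
  (val (a *: p + q))`_i = a * (val p)`_i + (val q)`_i.
Proof. by rewrite [val _]/= coefD coefZ. Qed.

Lemma lwBE (p q : L) i : (val (p - q))`_i = (val p)`_i - (val q)`_i.
Proof. by rewrite [val _]/= coefB. Qed.

Lemma lwZE a (p : L) i : (val (a *: p))`_i = a * (val p)`_i.
Proof. by rewrite [val _]/= coefZ. Qed.

Definition lw_Ep_poly (p : {poly K}) : {poly K} :=
  \poly_(i < (size p).+1) (if lw_null i then 0 else (p * 'X)`_i).
Definition lw_Em_poly (p : {poly K}) : {poly K} :=
  \poly_(i < size p) (- (i.+1%:R * (mu + i%:R) * p`_i.+1)).
Definition lw_H_poly (p : {poly K}) : {poly K} :=
  \poly_(i < size p) ((mu + i.*2%:R) * p`_i).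

Lemma coef_lw_Ep p i :
  (lw_Ep_poly p)`_i = if lw_null i then 0 else (p * 'X)`_i.
Proof.
rewrite coef_poly; case: ltnP => // pi; case: ifP => // _.
by rewrite nth_default// (leq_trans (size_polyMleq _ _))// size_polyX addnC.
Qed.

Lemma coef_lw_Em p i :
  (lw_Em_poly p)`_i = - (i.+1%:R * (mu + i%:R) * p`_i.+1).
Proof.
rewrite coef_poly; case: ltnP => // pi.
by rewrite nth_default ?mulr0 ?oppr0// (leq_trans pi).
Qed.

Lemma coef_lw_H p i : (lw_H_poly p)`_i = (mu + i.*2%:R) * p`_i.
Proof.
by rewrite coef_poly; case: ltnP => // pi; rewrite nth_default ?mulr0.
Qed.

Lemma lw_Ep_in (p : L) : lw_Ep_poly (val p) \in lw_pred.
Proof. by apply/asboolP => i hi; rewrite coef_lw_Ep hi. Qed.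
Lemma lw_Em_in (p : L) : lw_Em_poly (val p) \in lw_pred.
Proof.
apply/asboolP => i hi.
by rewrite coef_lw_Em lw_coef0 ?mulr0 ?oppr0//; exact: lw_nullS.
Qed.
Lemma lw_H_in (p : L) : lw_H_poly (val p) \in lw_pred.
Proof. by apply/asboolP => i hi; rewrite coef_lw_H lw_coef0// mulr0. Qed.

Definition lw_Ep (p : L) : L := Subspace (lw_Ep_in p).
Definition lw_Em (p : L) : L := Subspace (lw_Em_in p).
Definition lw_H (p : L) : L := Subspace (lw_H_in p).
Definition lw_Z (p : L) : L := nu *: p.

Lemma lwEpE p i :
  (val (lw_Ep p))`_i = if lw_null i then 0 else (val p * 'X)`_i.
Proof. exact: coef_lw_Ep. Qed.
Lemma lwEmE p i :
  (val (lw_Em p))`_i = - (i.+1%:R * (mu + i%:R) * (val p)`_i.+1).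
Proof. exact: coef_lw_Em. Qed.
Lemma lwHE p i : (val (lw_H p))`_i = (mu + i.*2%:R) * (val p)`_i.
Proof. exact: coef_lw_H. Qed.

Lemma lw_Ep_linear : linear lw_Ep.
Proof.
move=> a p q; apply: lw_eq => i; rewrite lwPE !lwEpE !coefMX.
case: ifP => _; first by rewrite mulr0 addr0.
by case: i => [|i] /=; [rewrite mulr0 addr0 | rewrite lwPE].
Qed.
Lemma lw_Em_linear : linear lw_Em.
Proof.
move=> a p q; apply: lw_eq => i; rewrite lwPE !lwEmE lwPE mulrDr opprD mulrN.
by congr (- _ + _); rewrite mulrCA.
Qed.
Lemma lw_H_linear : linear lw_H.
Proof.
by move=> a p q; apply: lw_eq => i; rewrite lwPE !lwHE lwPE mulrDr mulrCA.
Qed.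
Lemma lw_Z_linear : linear lw_Z.
Proof. by move=> a p q; rewrite /lw_Z scalerDr !scalerA mulrC. Qed.
HB.instance Definition _ := GRing.isLinear.Build K L L _ lw_Ep lw_Ep_linear.
HB.instance Definition _ := GRing.isLinear.Build K L L _ lw_Em lw_Em_linear.
HB.instance Definition _ := GRing.isLinear.Build K L L _ lw_H lw_H_linear.
HB.instance Definition _ := GRing.isLinear.Build K L L _ lw_Z lw_Z_linear.

Lemma lw_HEp v : lw_H (lw_Ep v) - lw_Ep (lw_H v) = 2 *: lw_Ep v.
Proof.
apply: lw_eq => i; rewrite lwBE lwZE lwHE !lwEpE !coefMX.
case: ifP => _; first by rewrite !mulr0 subrr.
case: i => [|i] /=; first by rewrite !mulr0 subrr.
rewrite lwHE -!mul2n !natrM; ring.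
Qed.

Lemma lw_HEm v : lw_H (lw_Em v) - lw_Em (lw_H v) = - 2 *: lw_Em v.
Proof.
apply: lw_eq => i; rewrite lwBE lwZE lwHE !lwEmE lwHE -!mul2n !natrM; ring.
Qed.

Lemma lw_EpEm v : lw_Ep (lw_Em v) - lw_Em (lw_Ep v) = lw_H v.
Proof.
apply: lw_eq => i; rewrite lwBE lwEpE lwEmE lwEpE lwHE !coefMX/=.
have [ni|ni] := boolP (lw_null i).
  by rewrite (lw_nullS ni) lw_coef0// !mulr0 oppr0 subrr.
have -> : i.+1%:R * (mu + i%:R) * (if lw_null i.+1 then 0 else (val v)`_i)
        = i.+1%:R * (mu + i%:R) * (val v)`_i.
  by case: ifP => // /lw_nullSE /(_ ni) ->; rewrite !mulr0 mul0r.
case: i ni => [|i] ni /=; first by rewrite double0; ring.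
by rewrite lwEmE -mul2n natrM; ring.
Qed.

Lemma lw_ZEp v : lw_Z (lw_Ep v) = lw_Ep (lw_Z v).
Proof. by rewrite /lw_Z linearZ. Qed.
Lemma lw_ZEm v : lw_Z (lw_Em v) = lw_Em (lw_Z v).
Proof. by rewrite /lw_Z linearZ. Qed.
Lemma lw_ZH v : lw_Z (lw_H v) = lw_H (lw_Z v).
Proof. by rewrite /lw_Z linearZ. Qed.

Definition lw_module : u11_module K :=
  @U11Module K L lw_Ep lw_Em lw_H lw_Z
    lw_HEp lw_HEm lw_EpEm lw_ZEp lw_ZEm lw_ZH.

Definition lw_mon_poly (m : nat) : {poly K} := if lw_null m then 0 else 'X^m.
Lemma lw_mon_in m : lw_mon_poly m \in lw_pred.
Proof.
apply/asboolP => i hi; rewrite /lw_mon_poly; case: ifP => [|nm]; first by rewrite coef0.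
by rewrite coefXn; case: eqP => // im; rewrite -im hi in nm.
Qed.
Definition lw_mon m : L := Subspace (lw_mon_in m).

Lemma lw_monE m i : (val (lw_mon m))`_i = if lw_null m then 0 else (i == m)%:R.
Proof. by rewrite /= /lw_mon_poly; case: ifP => _; rewrite ?coef0 ?coefXn. Qed.

Lemma lw_null0 : lw_null 0 = false.
Proof. by apply/negbTE/existsPn; case. Qed.

Lemma lw_mon0_neq0 : lw_mon 0 != 0.
Proof.
apply/eqP => /(congr1 (fun p : L => (val p)`_0)) /eqP.
by rewrite lw_monE lw_null0 eqxx [val 0]/= coef0 oner_eq0.
Qed.

Lemma lw_monS m : lw_Ep (lw_mon m) = lw_mon m.+1.
Proof.
apply: lw_eq => i; rewrite lwEpE coefMX !lw_monE.
case: i => [|i]; first by rewrite lw_null0 /= if_same.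
rewrite eqSS /=; case: (eqVneq i m) => [->|_]; last by rewrite !if_same.
case: (boolP (lw_null m.+1)) => [//|/negP nS].
by case: ifP => // /lw_nullS.
Qed.

Lemma lw_lowest : @u11_lowest_weight K lw_module mu nu (lw_mon 0).
Proof.
split=> //; first exact: lw_mon0_neq0.
  apply: lw_eq => i; rewrite lwEmE lw_monE lw_null0 mulr0 oppr0.
  by rewrite [val 0]/= coef0.
apply: lw_eq => i; rewrite lwHE lwZE lw_monE lw_null0.
by case: eqP => [->|_]; rewrite ?mulr0// double0 addr0.
Qed.

Lemma lw_irreducible : u11_irreducible lw_module.
Proof.
split; first by exists (lw_mon 0); exact: lw_mon0_neq0.
move=> U Ust.
have [[p pU p0]|U0] := pselect (exists2 p : L, p \in U & p != 0); last first.
  left=> v vU; apply/eqP/negP => /negP v0; apply: U0; by exists v.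
right.
have X0 : lw_mon 0 \in U.
  have [n] := ubnP (size (val p)); elim: n p pU p0 => // n IH p pU p0 sp.
  have [Ep0|Ep0] := eqVneq (lw_Em p) 0; last first.
    have [_ EmU _ _] := Ust _ pU; apply: (IH (lw_Em p)) => //.
    rewrite -ltnS; apply: leq_trans sp; rewrite ltnS.
    have sp0 : (0 < size (val p))%N.
      by rewrite size_poly_gt0; apply: contra_neq p0 => h; apply: val_inj.
    rewrite -(prednK sp0) ltnS; apply/leq_sizeP => i hi.
    rewrite lwEmE nth_default ?mulr0 ?oppr0//.
    by rewrite -(prednK sp0).
  have pS i : (val p)`_i.+1 = 0.
    have [|ni] := boolP (lw_null i.+1); first exact: lw_coef0.
    have := congr1 (fun q : L => (val q)`_i) Ep0.
    rewrite lwEmE [val 0]/= coef0 => /eqP; rewrite oppr_eq0 !mulf_eq0 pnatr_eq0/=.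
    by case/orP => [/eqP h|/eqP//]; rewrite lw_nullP in ni.
  have c0 : (val p)`_0 != 0.
    apply: contra_neq p0 => h; apply: lw_eq => -[|i]; by rewrite ?h ?pS [val 0]/= coef0.
  have -> : lw_mon 0 = ((val p)`_0)^-1 *: p.
    apply: lw_eq => i; rewrite lwZE lw_monE lw_null0.
    by case: i => [|i]; rewrite ?mulVf// pS mulr0.
  by rewrite rpredZ.
have XU m : lw_mon m \in U.
  elim: m => // m IH; rewrite -lw_monS; by have [] := Ust _ IH.
move=> v.
have -> : v = \sum_(i < size (val v)) (val v)`_i *: lw_mon i.
  apply: lw_eq => i; rewrite [val (\sum_(_ < _) _)]raddf_sum coef_sum.
  under eq_bigr => j _ do rewrite lwZE lw_monE.
  have [si|si] := ltnP i (size (val v)).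
    rewrite (bigD1 (Ordinal si))//= eqxx big1 ?addr0.
      case: ifP => [/lw_coef0->|_]; by rewrite ?mulr0 ?mulr1.
    move=> j ji; case: ifP => _; rewrite ?mulr0//.
    suff -> : (i == j) = false by rewrite mulr0.
    by apply: contraNF ji => /eqP ij; apply/eqP/val_inj.
  rewrite nth_default// big1// => j _; case: ifP => _; rewrite ?mulr0//.
  by rewrite gtn_eqF ?mulr0// (leq_trans (ltn_ord j)).
by apply: rpred_sum => i _; apply: rpredZ.
Qed.

End LowestWeightModel.

Lemma u11_irr_lowest_weight_exists (K : numFieldType) (mu nu : K) :
  exists L : u11_module K, u11_irr_lowest_weight mu nu L.
Proof.
exists (lw_module mu nu); split; first exact: lw_irreducible.
exists (lw_mon mu 0); exact: lw_lowest.
Qed.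

(* L_{u(1,1)}(mu, nu), well defined up to isomorphism. *)
Definition L_u11 (K : numFieldType) (mu nu : K) : u11_module K :=
  projT1 (cid (u11_irr_lowest_weight_exists mu nu)).

Lemma L_u11P (K : numFieldType) (mu nu : K) :
  u11_irr_lowest_weight mu nu (L_u11 mu nu).
Proof. exact: projT2 (cid (u11_irr_lowest_weight_exists mu nu)). Qed.

(* The complex numbers R[i], bundled so that all structures on them are inferred
   from a single one. *)
Definition Cx (R : realType) : numClosedFieldType := R[i].
Definition toCx (R : realType) (r : R) : Cx R := r%:C.
Definition iCx (R : realType) : Cx R := 'i.

Section ReflectionGroup.
Context {R : realType} {E : vectType R} {gT : finGroupType}.
Implicit Types (rho : gT -> 'End(E)).

(* For orthogonal rho s, fixing a hyperplane pointwise and nothing more means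
   that s is the orthogonal reflection in this hyperplane. *)
Definition reflections rho : {set gT} :=
  [set s | (\dim (fixedSpace (rho s))).+1 == \dim {:E}].

Definition dual_action rho (g : gT) (x : 'Hom(E, R^o)) : 'Hom(E, R^o) :=
  (x \o rho g^-1%g)%VF.

End ReflectionGroup.

(* A finite reflection group on the Euclidean space (E, form), together with
   the choice of the eigenvectors alpha_s, a_s and of the parameter c; the
   values of alpha, a and c outside the set of reflections are irrelevant. *)
Record reflection_datum (R : realType) (E : vectType R) (gT : finGroupType) :=
  ReflectionDatum {
    form : {dot E for idfun};
    rho : gT -> 'End(E);
    rho1 : rho 1%g = \1%VF;
    rhoM : forall g h, rho (g * h)%g = (rho g \o rho h)%VF;
    rho_inj : injective rho;
    rho_orth : forall g u v, form (rho g u) (rho g v) = form u v;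
    rho_gen : <<reflections rho>>%g = [set: gT];
    alpha : gT -> E;
    alphaP : forall s, s \in reflections rho ->
      alpha s != 0 /\ rho s (alpha s) = - alpha s;
    coalpha : gT -> 'Hom(E, R^o);
    coalphaP : forall s, s \in reflections rho ->
      coalpha s != 0 /\ dual_action rho s (coalpha s) = - coalpha s;
    cpar : gT -> (Cx R);
    cparJ : forall s g, s \in reflections rho -> cpar (s ^ g)%g = cpar s
  }.

Section RationalCherednik.
Context {R : realType} {E : vectType R} {gT : finGroupType}.
Variable D : reflection_datum E gT.
Local Notation C := (Cx R).
Local Notation Edual := 'Hom(E, R^o).
Local Notation Refl := (reflections (rho D)).

Definition coroot (s : gT) : Edual :=
  (2 / coalpha D s (alpha D s) : R) *: coalpha D s.

Definition rca_index : choiceType := (E + Edual + gT)%type.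
Local Notation F := (free_alg C rca_index).

Definition pre_vec (xi : E) : F := free_gen C (inl (inl xi) : rca_index).
Definition pre_cov (x : Edual) : F := free_gen C (inl (inr x) : rca_index).
Definition pre_grp (g : gT) : F := free_gen C (inr g : rca_index).

(* The first six families of relators present T(E_C + E_C^* ) >< G; the last
   three are the defining relations of the rational Cherednik algebra. *)
Inductive rca_rel : F -> Prop :=
| RcaVecLin (r : R) xi eta :
    rca_rel (pre_vec (r *: xi + eta) - (toCx r *: pre_vec xi + pre_vec eta))
| RcaCovLin (r : R) x y :
    rca_rel (pre_cov (r *: x + y) - (toCx r *: pre_cov x + pre_cov y))
| RcaGrp1 : rca_rel (pre_grp 1%g - 1)
| RcaGrpM g h : rca_rel (pre_grp (g * h)%g - pre_grp g * pre_grp h)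
| RcaGrpVec g xi :
    rca_rel (pre_grp g * pre_vec xi - pre_vec (rho D g xi) * pre_grp g)
| RcaGrpCov g x :
    rca_rel (pre_grp g * pre_cov x
             - pre_cov (dual_action (rho D) g x) * pre_grp g)
| RcaVecC xi eta :
    rca_rel (pre_vec xi * pre_vec eta - pre_vec eta * pre_vec xi)
| RcaCovC x y : rca_rel (pre_cov x * pre_cov y - pre_cov y * pre_cov x)
| RcaVecCov xi x :
    rca_rel (pre_vec xi * pre_cov x - pre_cov x * pre_vec xi
             - ((toCx (x xi))%:A
                - \sum_(s in Refl)
                    (toCx (x (alpha D s) * coroot s xi) * cpar D s)
                      *: pre_grp s)).

Definition rca := qalg rca_rel.
HB.instance Definition _ := GRing.Lmodule.on rca.
HB.instance Definition _ := GRing.PzRing.on rca.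

Definition rca_vec (xi : E) : rca := qpi _ (pre_vec xi).
Definition rca_cov (x : Edual) : rca := qpi _ (pre_cov x).
Definition rca_grp (g : gT) : rca := qpi _ (pre_grp g).

Lemma rca_scalerAr a (h k : rca) : a *: (h * k) = h * (a *: k).
Proof. exact: qalg_scalerAr. Qed.

End RationalCherednik.

(* J and the basis adapted to it: xi_j, eta_j orthonormal in E, with dual basis
   xx_j, yy_j of E^*. The determinant is taken in an arbitrary basis of E. *)
Record complex_frame (R : realType) (E : vectType R) (gT : finGroupType)
    (D : reflection_datum E gT) (n : nat) := ComplexFrame {
  Jstr : 'End(E);
  Jstr_orth : forall u v, form D (Jstr u) (Jstr v) = form D u v;
  Jstr_det : \det (passmx.mxof (vbasis {:E}) (vbasis {:E}) Jstr) = 1;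
  Jstr_skew : forall u v, form D (Jstr u) v = - form D u (Jstr v);
  vxi : 'I_n -> E;
  veta : 'I_n -> E;
  vxi_on : forall i j, form D (vxi i) (vxi j) = (i == j)%:R;
  veta_on : forall i j, form D (veta i) (veta j) = (i == j)%:R;
  vxi_veta : forall i j, form D (vxi i) (veta j) = 0;
  Jstr_xi : forall j, Jstr (vxi j) = - veta j;
  Jstr_eta : forall j, Jstr (veta j) = vxi j;
  xx : 'I_n -> 'Hom(E, R^o);
  yy : 'I_n -> 'Hom(E, R^o);
  xx_xi : forall i j, xx i (vxi j) = (i == j)%:R;
  xx_eta : forall i j, xx i (veta j) = 0;
  yy_xi : forall i j, yy i (vxi j) = 0;
  yy_eta : forall i j, yy i (veta j) = (i == j)%:R
}.

Record irrep (K : fieldType) (gT : finGroupType) := Irrep {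
  irr_space :> vectType K;
  irr_act : gT -> 'End(irr_space);
  irr_act1 : irr_act 1%g = \1%VF;
  irr_actM : forall g h, irr_act (g * h)%g = (irr_act g \o irr_act h)%VF;
  irr_neq0 : {:irr_space}%VS != 0%VS;
  irr_min : forall U : {vspace irr_space},
    (forall g, (irr_act g @: U <= U)%VS) -> U = 0%VS \/ U = {:irr_space}%VS
}.

Section U11Elements.
Context {R : realType} {E : vectType R} {gT : finGroupType}.
Context {D : reflection_datum E gT} {n : nat} (B : complex_frame D n).
Local Notation H := (rca D).

Definition rca_Ep : H :=
  2^-1 *: \sum_j (rca_cov D (xx B j) ^+ 2 + rca_cov D (yy B j) ^+ 2).
Definition rca_Em : H :=
  - (2^-1 *: \sum_j (rca_vec D (vxi B j) ^+ 2 + rca_vec D (veta B j) ^+ 2)).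
Definition rca_refl_sum : H :=
  \sum_(s in reflections (rho D)) cpar D s *: rca_grp D s.
Definition rca_H : H :=
  \sum_j (rca_cov D (xx B j) * rca_vec D (vxi B j)
          + rca_cov D (yy B j) * rca_vec D (veta B j))
  + n%:R - rca_refl_sum.
Definition rca_Z0 : H :=
  iCx R *: \sum_j (rca_cov D (xx B j) * rca_vec D (veta B j)
                         - rca_cov D (yy B j) * rca_vec D (vxi B j)).

(* Membership in the algebra V, the centraliser of u(1,1). *)
Definition centralises_u11 (h : H) : Prop :=
  [/\ h * rca_Ep = rca_Ep * h, h * rca_Em = rca_Em * h,
      h * rca_H = rca_H * h & h * rca_Z0 = rca_Z0 * h].

Definition is_rca_star (star : H -> H) : Prop :=
  [/\ forall (a : (Cx R)) h k, star (a *: h + k) = Num.conj a *: star h + star k,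
      star 1 = 1 /\ (forall h k, star (h * k) = star k * star h),
      forall h, star (star h) = h,
      forall j, [/\ star (rca_vec D (vxi B j)) = rca_cov D (xx B j),
                    star (rca_cov D (xx B j)) = rca_vec D (vxi B j),
                    star (rca_vec D (veta B j)) = rca_cov D (yy B j) &
                    star (rca_cov D (yy B j)) = rca_vec D (veta B j)] &
      forall s, s \in reflections (rho D) -> star (rca_grp D s) = rca_grp D s].

End U11Elements.

Section StandardModule.
Context {R : realType} {E : vectType R} {gT : finGroupType}.
Variables (D : reflection_datum E gT) (tau : irrep (Cx R) gT).
Local Notation H := (rca D).

(* Relators for the tensor product of H with tau to be balanced over the
   subalgebra generated by E and G, with E acting by zero on tau. *)
Inductive std_rel : tensor H tau -> Prop :=
| StdGrp h g v : std_rel (tens (h * rca_grp D g) v - tens h (irr_act tau g v))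
| StdVec h xi v : std_rel (tens (h * rca_vec D xi) v).

Definition std : lmodType (Cx R) := qmod std_rel.

Definition std_tens (h : H) (v : tau) : std := qpi std_rel (tens h v).
Definition std_in (v : tau) : std := std_tens 1 v.

Definition std_act_fun (h : H) : std -> std :=
  qlift (tlift (fun k v => std_tens (h * k) v)).

Lemma std_tensPl v : linear (std_tens^~ v).
Proof. by move=> a h k; rewrite /std_tens tensPl; exact: qpi_linear. Qed.
Lemma std_tensPr h : linear (std_tens h).
Proof. by move=> a v w; rewrite /std_tens tensPr; exact: qpi_linear. Qed.

Lemma std_act_pre_l h v : linear (fun k : H => std_tens (h * k) v).
Proof. by move=> a k k'; rewrite mulrDr -rca_scalerAr std_tensPl. Qed.
Lemma std_act_pre_r h k : linear (fun v : tau => std_tens (h * k) v).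
Proof. by move=> a v w; rewrite std_tensPr. Qed.

HB.instance Definition _ h := GRing.isLinear.Build _ _ _ _
  (tlift (fun (k : H) (v : tau) => std_tens (h * k) v))
  (tlift_linear (std_act_pre_l h) (std_act_pre_r h)).

Lemma std_act_ker h p :
  std_rel p -> tlift (fun (k : H) (v : tau) => std_tens (h * k) v) p = 0.
Proof.
have tE := tliftE (std_act_pre_l h) (std_act_pre_r h).
case=> [k g v|k xi v].
  rewrite linearB/=.
  transitivity (std_tens (h * (k * rca_grp D g)) v
                - std_tens (h * k) (irr_act tau g v)).
    by congr (_ - _); exact: tE.
  by rewrite /std_tens -linearB mulrA; exact/qpi_eq0/StdGrp.
transitivity (std_tens (h * (k * rca_vec D xi)) v); first exact: tE.
by rewrite /std_tens mulrA; exact/qpi_eq0/StdVec.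
Qed.

Lemma std_act_linear h : linear (std_act_fun h).
Proof. by apply: qlift_linear; exact: std_act_ker. Qed.
HB.instance Definition _ h :=
  GRing.isLinear.Build (Cx R) std std _ (std_act_fun h) (std_act_linear h).
Definition std_act (h : H) : {linear std -> std} := std_act_fun h.

Lemma std_actE h k v : std_act h (std_tens k v) = std_tens (h * k) v.
Proof.
rewrite /std_act/= /std_act_fun qlift_pi; last exact: std_act_ker.
exact: (tliftE (std_act_pre_l h) (std_act_pre_r h)).
Qed.

(* The degree k part is spanned by the vectors x_1 ... x_k v with x_i in E^*
   and v in tau. *)
Definition std_deg (k : nat) : {pred std} :=
  lspan [set m | exists (x : k.-tuple 'Hom(E, R^o)) (v : tau),
                 m = std_act (\prod_(i < k) rca_cov D (tnth x i)) (std_in v)].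
HB.instance Definition _ k := GRing.SubmodClosed.on (std_deg k).

Definition std_irreducible : Prop :=
  (exists m : std, m != 0) /\
  forall U : submodClosed std,
    (forall h m, m \in U -> std_act h m \in U) ->
    (forall m, m \in U -> m = 0) \/ (forall m, m \in U).

Definition contravariant_form (star : H -> H)
    (beta : {hermitian_sym std for Num.conj}) : Prop :=
  [/\ forall h p q, beta (std_act h p) q = beta p (std_act (star h) q),
      forall v : tau, v != 0 -> 0 < beta (std_in v) (std_in v) &
      forall g (v w : tau), beta (std_in (irr_act tau g v)) (std_in (irr_act tau g w))
                  = beta (std_in v) (std_in w)].

Definition unitarisable (star : H -> H) : Prop :=
  exists2 beta : {hermitian_sym std for Num.conj},
    contravariant_form star beta & forall m : std, m != 0 -> 0 < beta m m.

End StandardModule.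
Arguments std_tens {R E gT} D tau h v.
Arguments std_in {R E gT} D tau v.
Arguments std_act {R E gT D tau} h.
Arguments std_deg {R E gT} D tau k.
Arguments unitarisable {R E gT} D tau star.

Section Harmonics.
Context {R : realType} {E : vectType R} {gT : finGroupType}.
Context {D : reflection_datum E gT} {n : nat} (B : complex_frame D n).
Variable tau : irrep (Cx R) gT.
Local Notation M := (std D tau).

Definition harmonic (k : nat) : {pred M} :=
  fun p => (p \in std_deg D tau k) && (std_act (rca_Em B) p == 0).

Definition spectrum (k : nat) : {pred (Cx R)} :=
  fun l => `[< exists2 p : M, p \in harmonic k /\ p != 0 &
                           std_act (rca_Z0 B) p = l *: p >].

Definition harmonic_eig (k : nat) (l : (Cx R)) : {pred M} :=
  fun p => (p \in harmonic k) && (std_act (rca_Z0 B) p == l *: p).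

Lemma harmonic_eigP k l p :
  reflect [/\ p \in std_deg D tau k, std_act (rca_Em B) p = 0
            & std_act (rca_Z0 B) p = l *: p] (p \in harmonic_eig k l).
Proof.
apply: (iffP andP) => [[/andP[? /eqP ?] /eqP ?] // | [? /eqP ? /eqP ?]].
by split=> //; apply/andP; split.
Qed.

Lemma harmonic_eig_closed k l : submod_closed (harmonic_eig k l).
Proof.
split.
  apply/harmonic_eigP; split; first exact: rpred0.
    exact: linear0.
  by rewrite linear0 scaler0.
move=> a p q /harmonic_eigP[pk p0 pl] /harmonic_eigP[qk q0 ql].
apply/harmonic_eigP; split.
- by apply: rpredD => //; exact: rpredZ.
- by rewrite linearP p0 q0 scaler0 addr0.
- by rewrite linearP pl ql scalerDr !scalerA mulrC.
Qed.
HB.instance Definition _ k l :=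
  GRing.isSubmodClosed.Build (Cx R) M (harmonic_eig k l) (harmonic_eig_closed k l).

Definition joint_summand (N : (Cx R)) (k : nat) (l : {l | l \in spectrum k}) :=
  tensor (subspace (harmonic_eig k (val l)))
         (L_u11 (k%:R + n%:R - N) (val l)).

Definition joint_sum (N : (Cx R)) : lmodType (Cx R) :=
  dsum (fun k : nat => dsum (joint_summand N (k := k))).

Definition joint_pure (N : (Cx R)) (k : nat) (l : {l | l \in spectrum k})
    (p : subspace (harmonic_eig k (val l)))
    (v : L_u11 (k%:R + n%:R - N) (val l)) : joint_sum N :=
  din (fun k : nat => dsum (joint_summand N (k := k))) k
    (din (joint_summand N (k := k)) l (tens p v)).

End Harmonics.
Arguments harmonic {R E gT D n} B tau k.
Arguments spectrum {R E gT D n} B tau k.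
Arguments harmonic_eig {R E gT D n} B tau k l.
Arguments joint_summand {R E gT D n} B tau N k l.
Arguments joint_sum {R E gT D n} B tau N.
Arguments joint_pure {R E gT D n} B tau N k l p v.

(* Main.v *)
Require Import Defs.
From HB Require Import structures.
From mathcomp Require Import all_boot all_order all_algebra all_fingroup.
From mathcomp Require Import boolp classical_sets reals.
From mathcomp Require Import complex monalg ring.

Set Implicit Arguments.
Unset Strict Implicit.
Unset Printing Implicit Defensive.

Import Order.TTheory GRing.Theory Num.Theory.
Local Open Scope ring_scope.

(** Everything rests on three facts about the operators E_+, E_-, H, Z_0 on the
    standard module M: they satisfy the relations of u(1,1), they are (skew-)
    adjoint for the contravariant form, and they respect the grading
    M = sum_k M_k by polynomial degree, whose pieces are finite-dimensional and
    are the eigenspaces of H.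

    The commutation relations follow from the defining relations of the
    Cherednik algebra. The terms containing group elements cancel because
    G_s x_w = - x_w G_s when x_w is the covector dual to the root of s, and
    because the reflection formula s.x = x - <x, alpha> alpha^v turns the
    commutator with sum_s c(s) s into the terms produced by the Euler element
    ([euler_comm], [vec_sqnorm], [cov_vec_sqnorm]). Only brackets with E_+ are
    computed: the anti-involution exchanges E_+ and - E_-, fixes Z_0, and hence
    fixes H = [E_+, E_-], so it produces the brackets with E_- from those.

    Positivity of the form yields the decomposition without any multiplicity
    count. A self-adjoint operator on a finite-dimensional space is
    diagonalisable ([selfadj_eigenspan]). Applied to E_+ E_- on M_k, this writes
    M_k as ker E_- plus E_+ M_{k-2}: an eigenvector v with eigenvalue 0 has
    <E_- v, E_- v> = 0, and an eigenvector with another eigenvalue lies in the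
    image of E_+. Applied to Z_0 on ker E_-, it produces the spaces
    H_{k,lambda}. By induction on k, M is spanned by the vectors E_+^i p with p
    in some H_{k,lambda}. Vectors with different (k, lambda, i) are orthogonal,
    having different weights or different heights in their strings
    ([tower_orth_neq], [isotypic_orth]), so the sum is direct.

    It remains to match each string with the irreducible module of the same
    lowest weight (mu, nu). In the irreducible module with lowest weight vector
    v_0 and in M alike, E_-^i E_+^i multiplies the lowest weight vector by the
    product of the numbers -(j+1)(mu+j), j < i. In the irreducible module
    E_+^i v_0 vanishes exactly when this product does, since for mu + j = 0 a
    nonzero E_+^(j+1) v_0 would generate a proper submodule ([u11_irr_nullE]); in
    M the same holds for E_+^i p by positivity ([unitary_null], [tower_eq0]). Hence
    E_+^i v_0 |-> E_+^i p is a well defined injective intertwiner, linear in p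
    ([L_mapE]), and operators commuting with u(1,1) act through p alone. *)

(** * Free modules, tensor products and direct sums *)

Lemma malg_ind (K : nzRingType) (X : choiceType) (P : {malg K[X]} -> Prop) :
  P 0 -> (forall a u v, P u -> P v -> P (a *: u + v)) ->
  (forall x, P << x >>) -> forall p, P p.
Proof.
move=> P0 PD PX p; rewrite (monalgE p); elim/big_ind: _ => //.
  by move=> u v Pu Pv; rewrite -[u]scale1r; apply: PD.
move=> x _; have -> : << p@_x *g x >> = p@_x *: << x >> + 0 :> {malg K[X]}.
  apply/malgP => y; rewrite addr0 mcoeffZ !mcoeffU.
  by case: eqP; rewrite ?mulr1n ?mulr1 ?mulr0n ?mulr0.
exact: PD.
Qed.

Lemma qmod_ind (K : nzRingType) (X : choiceType) (S : set {malg K[X]})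
    (P : qmod S -> Prop) :
  P 0 -> (forall a u v, P u -> P v -> P (a *: u + v)) ->
  (forall x, P (qpi S << x >>)) -> forall u, P u.
Proof.
move=> P0 PD PX u; rewrite -[u]qreprK; elim/malg_ind: (qrepr u) => //.
- by rewrite linear0.
- by move=> a p q Pp Pq; rewrite linearP; exact: PD.
Qed.

Lemma tensor_ind (K : nzRingType) (U W : lmodType K) (P : tensor U W -> Prop) :
  P 0 -> (forall a u v, P u -> P v -> P (a *: u + v)) ->
  (forall u w, P (tens u w)) -> forall z, P z.
Proof. by move=> P0 PD PT; apply: qmod_ind => // -[u w]; exact: PT. Qed.

Section DirectSumTheory.
Context {K : nzRingType} {I : choiceType} (A : I -> lmodType K).

Lemma dsum_ind (P : dsum A -> Prop) :
  P 0 -> (forall a u v, P u -> P v -> P (a *: u + v)) ->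
  (forall i (u : A i), P (din A i u)) -> forall z, P z.
Proof. by move=> P0 PD PT; apply: qmod_ind => // -[i u]; exact: PT. Qed.

(** The indices are made distinct and u vanishes off s, so that two such
    expressions can be brought to a common index set before they are added. *)
Lemma dsum_sum (z : dsum A) :
  exists2 s : seq I, uniq s & exists u : forall i, A i,
    (forall i, i \notin s -> u i = 0) /\ z = \sum_(i <- s) din A i (u i).
Proof.
elim/dsum_ind: z => [|a z z' [s us [u [u0 ->]]] [s' us' [u' [u'0 ->]]]|i x].
- by exists [::] => //; exists (fun=> 0); rewrite big_nil.
- have widen (r : seq I) (v : forall i, A i) : uniq r ->
      {subset r <= undup (s ++ s')} -> (forall i, i \notin r -> v i = 0) ->
      \sum_(i <- r) din A i (v i) = \sum_(i <- undup (s ++ s')) din A i (v i).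
    move=> ur sr v0; rewrite [RHS](bigID (mem r))/= [X in _ + X]big1 ?addr0.
      rewrite -[RHS]big_filter; apply/perm_big/uniq_perm => //.
        by rewrite filter_uniq// undup_uniq.
      move=> i; rewrite mem_filter; case ir : (i \in r) => //=.
      by rewrite sr.
    by move=> i ir; rewrite v0// linear0.
  exists (undup (s ++ s')); first exact: undup_uniq.
  exists (fun i => a *: u i + u' i); split.
    move=> i; rewrite mem_undup mem_cat negb_or => /andP[/u0 -> /u'0 ->].
    by rewrite scaler0 addr0.
  rewrite (widen s u)// ?(widen s' u')//; last first.
  + by move=> i si; rewrite mem_undup mem_cat si.
  + by move=> i si; rewrite mem_undup mem_cat si orbT.
  by rewrite scaler_sumr -big_split/=; apply: eq_bigr => i _; rewrite linearP.
- pose u j : A j := if pselect (i = j) is left e then ecast j (A j) e x else 0.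
  exists [:: i] => //; exists u; split=> [j|].
    by rewrite inE /u; case: pselect => // e; case: _ / e; rewrite eqxx.
  rewrite big_seq1 /u; case: pselect => // e; congr (din A i _).
  by rewrite (eq_irrelevance e erefl).
Qed.

Section Lift.
Context {W : lmodType K} (f : forall i, {linear A i -> W}).

Definition dlift : dsum A -> W :=
  qlift (flift (fun x : {i : I & A i} => f (tag x) (tagged x))).

Lemma dlift_ker p : dsum_rel (A := A) p ->
  flift (fun x : {i : I & A i} => f (tag x) (tagged x)) p = 0.
Proof.
by case=> i a u v; rewrite linearB/= linearP/= !fliftU/= linearP subrr.
Qed.

Lemma dlift_linear : linear dlift.
Proof. by apply: qlift_linear; exact: dlift_ker. Qed.
HB.instance Definition _ := GRing.isLinear.Build K (dsum A) W _ dlift dlift_linear.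

Lemma dliftE i u : dlift (din A i u) = f i u.
Proof.
by rewrite /dlift /din qlift_pi => [|p]; [rewrite /= fliftU | exact: dlift_ker].
Qed.

(** Injectivity splits into injectivity of each component and
    independence of the images. *)
Lemma dlift_inj :
  (forall i u, f i u = 0 -> u = 0) ->
  (forall (s : seq I) (u : forall i, A i), uniq s ->
     \sum_(i <- s) f i (u i) = 0 -> forall i, i \in s -> f i (u i) = 0) ->
  forall z, dlift z = 0 -> z = 0.
Proof.
move=> f_inj f_ind z; have [s us [u [_ ->]]] := dsum_sum z.
rewrite linear_sum/=; under eq_bigr do rewrite dliftE.
move=> /(f_ind s u us) fu; rewrite big_seq big1// => i /fu /f_inj ->.
exact: linear0.
Qed.

End Lift.
End DirectSumTheory.
Arguments dlift {K I} A {W} f z.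

(** Applying T - a_x removes the term at x and multiplies the others by
    nonzero scalars, which gives an induction on the number of terms. *)
Lemma eigen_indep (K : fieldType) (V : lmodType K) (T : {linear V -> V})
    (I : eqType) (s : seq I) (w : I -> V) (a : I -> K) :
  uniq s -> {in s &, injective a} -> (forall i, i \in s -> T (w i) = a i *: w i) ->
  \sum_(i <- s) w i = 0 -> forall i, i \in s -> w i = 0.
Proof.
elim: s w => //= x s IH w /andP[xs us] ainj Tw; rewrite big_cons => sw0.
have ws i : i \in s -> w i = 0.
  move=> is_.
  have xi : a i - a x != 0.
    rewrite subr_eq0; apply: contraNneq xs => aix.
    by rewrite -(ainj i x) ?inE ?eqxx ?is_ ?orbT.
  suff h : (a i - a x) *: w i = 0.
    by apply/eqP; move/eqP: h; rewrite scaler_eq0 (negPf xi).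
  apply: (IH (fun i => (a i - a x) *: w i)) => //.
  - by move=> j k js ks; apply: ainj; rewrite inE ?js ?ks orbT.
  - by move=> j js; rewrite linearZ/= Tw ?inE ?js ?orbT// !scalerA mulrC.
  have: T (w x + \sum_(j <- s) w j) - a x *: (w x + \sum_(j <- s) w j) = 0.
    by rewrite sw0 linear0 scaler0 subrr.
  rewrite linearD/= scalerDr Tw ?inE ?eqxx// opprD addrACA subrr add0r.
  rewrite linear_sum/= scaler_sumr -sumrB.
  move=> h0; rewrite -[RHS]h0; rewrite big_seq [RHS]big_seq; apply: eq_bigr => j js.
  by rewrite Tw ?inE ?js ?orbT// scalerBl.
move=> i; rewrite inE => /orP[/eqP ->|/ws//].
by move: sw0; rewrite big_seq big1 ?addr0// => j /ws.
Qed.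

(** * Reflections and the orthonormal frame *)

Section Reflections.
Context {R : realType} {E : vectType R} {gT : finGroupType}.
Variable D : reflection_datum E gT.
Local Notation Edual := 'Hom(E, R^o).
Local Notation Refl := (reflections (rho D)).
Implicit Types (x y : Edual) (xi eta : E) (g : gT).

Lemma rho1E xi : rho D 1%g xi = xi. Proof. by rewrite rho1 id_lfunE. Qed.
Lemma rhoME g1 g2 xi : rho D (g1 * g2)%g xi = rho D g1 (rho D g2 xi).
Proof. by rewrite rhoM comp_lfunE. Qed.
Lemma rhoK g : cancel (rho D g) (rho D g^-1%g).
Proof. by move=> u; rewrite -rhoME mulVg rho1E. Qed.

Lemma rhoVK g : cancel (rho D g^-1%g) (rho D g).
Proof. by move=> u; rewrite -rhoME mulgV rho1E. Qed.

Lemma dual_actionE g x xi : dual_action (rho D) g x xi = x (rho D g^-1%g xi).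
Proof. by rewrite /dual_action comp_lfunE. Qed.

Section Reflection.
Variable s : gT.
Hypothesis sR : s \in Refl.

Lemma reflection_alphaV : rho D s^-1%g (alpha D s) = - alpha D s.
Proof.
have [_ sa] := alphaP sR; apply: (can_inj (rhoK s)).
by rewrite rhoVK linearN/= sa opprK.
Qed.

(** The fixed space of s is a hyperplane and alpha_s, being a
    (-1)-eigenvector, lies outside it. *)
Lemma reflection_decomp xi :
  exists2 f, f \in fixedSpace (rho D s) & exists r : R, xi = f + r *: alpha D s.
Proof.
have [a0 sa] := alphaP sR; set F := fixedSpace _.
have aF : alpha D s \notin F.
  apply: contra_neqN a0 => /fixedSpaceP; rewrite sa => /eqP.
  by rewrite eq_sym -subr_eq0 opprK -mulr2n -scaler_nat scaler_eq0 pnatr_eq0 => /eqP.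
have dFa : (F :&: <[alpha D s]> = 0)%VS.
  apply/eqP; rewrite -subv0; apply/subvP => v /memv_capP[vF /vlineP[r vr]].
  rewrite memv0 vr; apply: contraR aF; rewrite scaler_eq0 negb_or => /andP[r0 _].
  by rewrite -(scale1r (alpha D s)) -(mulVf r0) -scalerA -vr memvZ.
have full : (F + <[alpha D s]> = {:E})%VS.
  apply/eqP; rewrite eqEdim subvf /= dimv_disjoint_sum// dim_vline a0 addn1.
  by move: sR; rewrite inE => /eqP ->.
have: xi \in (F + <[alpha D s]>)%VS by rewrite full memvf.
by case/memv_addP => f fF [_ /vlineP[r ->] ->]; exists f => //; exists r.
Qed.

Lemma coalpha_fixed f : f \in fixedSpace (rho D s) -> coalpha D s f = 0.
Proof.
have [_ sb] := coalphaP sR => /fixedSpaceP sf.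
have := congr1 (fun h : Edual => h f) sb.
rewrite dual_actionE -{1}sf rhoK opp_lfunE => /eqP.
by rewrite -subr_eq0 opprK -mulr2n mulrn_eq0 => /eqP.
Qed.

Lemma coalpha_alpha : coalpha D s (alpha D s) != 0.
Proof.
have [b0 _] := coalphaP sR; apply: contra_neq b0 => ba.
apply/lfunP => xi; have [f /coalpha_fixed bf [r ->]] := reflection_decomp xi.
by rewrite linearD linearZ/= bf ba scaler0 addr0 zero_lfunE.
Qed.

Lemma corootE xi : coroot D s xi = 2 / coalpha D s (alpha D s) * coalpha D s xi.
Proof. by rewrite /coroot scale_lfunE. Qed.

Lemma coroot_alpha : coroot D s (alpha D s) = 2.
Proof. by rewrite corootE mulfVK// coalpha_alpha. Qed.

(** Both sides are linear, fix the hyperplane of s and negate alpha_s. *)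
Lemma reflectionVE xi : rho D s^-1%g xi = xi - coroot D s xi *: alpha D s.
Proof.
have [f fF [r ->]] := reflection_decomp xi.
have sf : rho D s^-1%g f = f by move/fixedSpaceP: (fF) => {1}<-; rewrite rhoK.
rewrite !linearD !linearZ/= sf reflection_alphaV coroot_alpha.
rewrite corootE (coalpha_fixed fF) mulr0 add0r -addrA; congr (_ + _).
by rewrite !scalerN -scaleNr -scalerBl; congr (_ *: _); rewrite /GRing.scale/=; ring.
Qed.

Lemma dual_reflectionE x :
  dual_action (rho D) s x = x - x (alpha D s) *: coroot D s.
Proof.
apply/lfunP => xi; rewrite dual_actionE reflectionVE linearB linearZ/=.
by rewrite add_lfunE opp_lfunE [in RHS]scale_lfunE; congr (_ - _); exact: mulrC.
Qed.

End Reflection.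
End Reflections.

Section Frame.
Context {R : realType} {E : vectType R} {gT : finGroupType}.
Context {D : reflection_datum E gT} {n : nat} (B : complex_frame D n).
Hypothesis dimE : \dim {:E} = (2 * n)%N.
Local Notation Edual := 'Hom(E, R^o).
Local Notation I := ('I_n + 'I_n)%type.

(** Treating xi_1, ..., xi_n, eta_1, ..., eta_n as one family makes the
    sums over pairs of variables single sums over an orthonormal basis. *)
Definition frame_vec (a : I) : E :=
  match a with inl j => vxi B j | inr j => veta B j end.
Definition frame_cov (a : I) : Edual :=
  match a with inl j => xx B j | inr j => yy B j end.

Lemma frame_covE a b : frame_cov a (frame_vec b) = (a == b)%:R.
Proof.
by case: a b => [i|i] [j|j] /=; rewrite ?xx_xi ?xx_eta ?yy_xi ?yy_eta.
Qed.

Lemma frame_vec_form a b : Defs.form D (frame_vec a) (frame_vec b) = (a == b)%:R.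
Proof.
case: a b => [i|i] [j|j] /=; rewrite ?vxi_on ?veta_on ?vxi_veta//.
by rewrite hermC mul1r /= vxi_veta.
Qed.

(** Orthonormality makes the 2n frame vectors independent; as dim E = 2n
    they form a basis, in which the coordinates are read off by the dual frame. *)
Lemma frame_vec_decomp u : u = \sum_a frame_cov a u *: frame_vec a.
Proof.
pose b := mktuple (fun i : 'I_#|{: I}| => frame_vec (enum_val i)).
have bE (i : 'I_#|{: I}|) : b`_i = frame_vec (enum_val i) by rewrite nth_mktuple.
have bP : basis_of {:E} b.
  have -> : basis_of {:E} b = free b.
    have le : (\dim {:E} <= size b)%N.
      by rewrite size_tuple dimE card_sum card_ord mul2n addnn.
    by rewrite basisEfree subvf le !andbT.
  apply/freeP => k k0 i.
  have := congr1 (frame_cov (enum_val i)) k0; rewrite linear0 linear_sum.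
  rewrite (bigD1 i)//= big1 ?addr0 => [|j ji].
    by rewrite bE linearZ/= frame_covE eqxx => <-; rewrite [RHS]mulr1.
  rewrite bE linearZ/= frame_covE (inj_eq enum_val_inj) eq_sym (negPf ji).
  by rewrite scaler0.
have uE := coord_basis bP (memvf u).
rewrite {1}uE (reindex_onto enum_rank enum_val)/= => [|i _]; last exact: enum_valK.
apply: eq_big => [a|a _]; first by rewrite enum_rankK eqxx.
rewrite bE enum_rankK; congr (_ *: _).
rewrite [in RHS]uE linear_sum (bigD1 (enum_rank a))//= big1 ?addr0 => [|j ja].
  by rewrite bE linearZ/= frame_covE enum_rankK eqxx [RHS]mulr1.
rewrite bE linearZ/= frame_covE -{1}(enum_rankK a) (inj_eq enum_val_inj).
by rewrite eq_sym (negPf ja) scaler0.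
Qed.

Lemma frame_cov_decomp (x : Edual) : x = \sum_a x (frame_vec a) *: frame_cov a.
Proof.
apply/lfunP => u; rewrite {1}[u]frame_vec_decomp linear_sum sum_lfunE.
by apply: eq_bigr => a _; rewrite linearZ/= scale_lfunE; exact: mulrC.
Qed.

(** The isomorphism from E to its dual given by the inner product
    ([flatE]). *)
Definition flat (v : E) : Edual := \sum_a frame_cov a v *: frame_cov a.

Lemma flatE v u : flat v u = Defs.form D v u.
Proof.
rewrite sum_lfunE {2}[v]frame_vec_decomp linear_sumlz; apply: eq_bigr => a _.
rewrite linearZl_LR scale_lfunE; congr (_ * _).
rewrite {2}[u]frame_vec_decomp linear_sumr (bigD1 a)//= big1 ?addr0 => [|b ba].
  by rewrite linearZr_LR /= frame_vec_form eqxx mulr1.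
by rewrite linearZr_LR /= frame_vec_form eq_sym (negPf ba) mulr0.
Qed.

(** By [flatE] this only says that s is orthogonal and negates
    alpha_s. *)
Lemma flat_alpha s : s \in reflections (rho D) ->
  dual_action (rho D) s (flat (alpha D s)) = - flat (alpha D s).
Proof.
move=> sR; have [_ sa] := alphaP sR; apply/lfunP => u.
rewrite dual_actionE opp_lfunE !flatE -(rho_orth D s) sa linearNl.
by rewrite rhoVK.
Qed.

End Frame.

(** * Commutators in a ring satisfying the Cherednik relations *)

Section CherednikRelations.
Context {R : realType} {E : vectType R} {gT : finGroupType}.
Context {D : reflection_datum E gT} {n : nat} (B : complex_frame D n).
Hypothesis dimE : \dim {:E} = (2 * n)%N.
Local Notation Edual := 'Hom(E, R^o).
Local Notation I := ('I_n + 'I_n)%type.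
Local Notation Refl := (reflections (rho D)).
Local Notation e := (frame_vec B).
Local Notation f := (frame_cov B).

Variables (A : pzRingType) (t : {rmorphism R -> A}) (cc : gT -> A).
Variables (X : Edual -> A) (V : E -> A) (G : gT -> A).
Hypothesis tC : forall r a, t r * a = a * t r.
Hypothesis ccC : forall s a, cc s * a = a * cc s.
Hypothesis X_sum : forall (J : finType) (r : J -> R) (v : J -> Edual),
  X (\sum_i r i *: v i) = \sum_i t (r i) * X (v i).
Hypothesis XC : forall x y, X x * X y = X y * X x.
Hypothesis GX : forall g x, G g * X x = X (dual_action (rho D) g x) * G g.
Hypothesis VX : forall u x, V u * X x = X x * V u
  + (t (x u) - \sum_(s in Refl) cc s * t (x (alpha D s)) * t (coroot D s u) * G s).

(** The Leibniz rule for commutators with h. *)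
Lemma comm_mul (h u v u' v' : A) : h * u = u * h + u' -> h * v = v * h + v' ->
  h * (u * v) = u * v * h + (u' * v + u * v').
Proof.
by move=> hu hv; rewrite mulrA hu mulrDl -mulrA hv mulrDr mulrA -!addrA (addrC (u * v')).
Qed.

Lemma comm_sum (J : finType) (h : A) (u u' : J -> A) :
  (forall j, h * u j = u j * h + u' j) ->
  h * (\sum_j u j) = (\sum_j u j) * h + \sum_j u' j.
Proof.
move=> hu; rewrite mulr_sumr mulr_suml -big_split/=.
by apply: eq_bigr => j _; rewrite hu.
Qed.

Lemma cov_expand x : X x = \sum_a t (x (e a)) * X (f a).
Proof. by rewrite {1}[x](frame_cov_decomp B dimE) X_sum. Qed.

Lemma cov_opp x : X (- x) = - X x.
Proof.
rewrite cov_expand [in RHS]cov_expand -sumrN.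
by apply: eq_bigr => a _; rewrite opp_lfunE rmorphN mulNr.
Qed.

Lemma cov_subZ x (r : R) y : X (x - r *: y) = X x - t r * X y.
Proof.
rewrite cov_expand [X x]cov_expand [X y]cov_expand mulr_sumr -sumrB.
apply: eq_bigr => a _; rewrite add_lfunE opp_lfunE scale_lfunE.
by rewrite mulrA -mulrBl -rmorphM -rmorphB.
Qed.

Lemma coef_swap s r1 r2 : cc s * t r1 * t r2 = cc s * t r2 * t r1.
Proof. by rewrite -!mulrA; congr (_ * _); exact: tC. Qed.

Lemma coefC s r1 r2 a : cc s * t r1 * t r2 * a = a * (cc s * t r1 * t r2).
Proof.
by rewrite -(mulrA _ (t r2)) tC mulrA -(mulrA _ (t r1)) tC !mulrA ccC.
Qed.

(** The element of the tensor product of the dual of E with E corresponding to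
    the endomorphism [cov_map p] of the dual: p = f gives the Euler element, and
    a rotation of f gives Z_0 up to a factor i. *)
Definition cov_vec (p : I -> Edual) : A := \sum_a X (p a) * V (e a).
Definition cov_map (p : I -> Edual) (x : Edual) : Edual := \sum_a x (e a) *: p a.

(** Only the vector factors contribute, through the defining relation; the
    sum over the basis then reassembles the covectors p(x) and p(alpha^v). *)
Lemma cov_vec_comm p x : cov_vec p * X x = X x * cov_vec p
  + (X (cov_map p x)
     - \sum_(s in Refl) cc s * t (x (alpha D s)) * X (cov_map p (coroot D s)) * G s).
Proof.
rewrite /cov_vec mulr_suml mulr_sumr X_sum.
under [X in _ = _ + (_ - X)]eq_bigr => s _ do rewrite X_sum mulr_sumr mulr_suml.
rewrite exchange_big/= -sumrB -big_split/=; apply: eq_bigr => a _.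
rewrite -mulrA VX mulrDr mulrA -XC mulrA; congr (_ + _).
rewrite mulrBr tC; congr (_ - _).
rewrite mulr_sumr; apply: eq_bigr => s _.
by rewrite !mulrA; congr (_ * _); rewrite coefC !mulrA.
Qed.

Definition refl_sum : A := \sum_(s in Refl) cc s * G s.

Lemma cov_map_id x : cov_map f x = x.
Proof. by rewrite [RHS](frame_cov_decomp B dimE). Qed.

Lemma refl_sum_comm x : refl_sum * X x = X x * refl_sum
  - \sum_(s in Refl) cc s * t (x (alpha D s)) * X (coroot D s) * G s.
Proof.
rewrite mulr_suml mulr_sumr -sumrB; apply: eq_bigr => s sR.
rewrite -mulrA GX dual_reflectionE// cov_subZ mulrBl mulrBr !mulrA.
by rewrite ccC.
Qed.

Definition euler : A := cov_vec f + n%:R - refl_sum.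

(** The reflection terms of the commutator with the Euler element are
    those of [refl_sum_comm], hence cancel in the difference. *)
Lemma euler_comm x : euler * X x = X x * euler + X x.
Proof.
rewrite /euler !mulrBl mulrDl cov_vec_comm refl_sum_comm cov_map_id.
under eq_bigr do rewrite cov_map_id.
set Y := \sum_(s in _) _; rewrite mulrBr mulrDr mulr_natl mulr_natr opprB.
rewrite addrAC -(addrA _ (_ - Y)) (addrA (X x - Y)) subrK addrAC addrA.
by rewrite [LHS]addrAC.
Qed.

Definition sqnorm : A := t 2^-1 * \sum_a X (f a) ^+ 2.

Lemma half_double (a : A) : t 2^-1 * (a + a) = a.
Proof.
have h : 2^-1 + 2^-1 = 1 :> R by rewrite [RHS](splitr 1) mul1r.
by rewrite mulrDr -mulrDl -rmorphD h rmorph1 mul1r.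
Qed.

Lemma euler_sqnorm : euler * sqnorm - sqnorm * euler = sqnorm *+ 2.
Proof.
apply/eqP; rewrite subr_eq addrC mulr2n; apply/eqP.
have h : euler * \sum_a X (f a) ^+ 2 = (\sum_a X (f a) ^+ 2) * euler
    + (\sum_a X (f a) ^+ 2 + \sum_a X (f a) ^+ 2).
  rewrite -big_split/=; apply: comm_sum => a; rewrite expr2.
  by apply: comm_mul; exact: euler_comm.
by rewrite /sqnorm mulrA -tC -mulrA h mulrDr mulrA -mulrDr.
Qed.

Lemma flat_sum (v : E) : \sum_a t (f a v) * X (f a) = X (flat B v).
Proof. by rewrite X_sum. Qed.

Lemma grp_flat s : s \in Refl ->
  G s * X (flat B (alpha D s)) = - X (flat B (alpha D s)) * G s.
Proof. by move=> sR; rewrite GX flat_alpha// cov_opp. Qed.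

(** Summed over the basis, the reflection term of s becomes
    G_s X_w + X_w G_s for the covector w dual to alpha_s, and this vanishes since
    s negates w. *)
Lemma vec_sqnorm u : V u * sqnorm = sqnorm * V u + X (flat B u).
Proof.
have h a : V u * X (f a) ^+ 2 = X (f a) ^+ 2 * V u + (t (f a u) * X (f a) * 2
    - \sum_(s in Refl) cc s * t (coroot D s u) *
       (G s * (t (f a (alpha D s)) * X (f a)) + (t (f a (alpha D s)) * X (f a)) * G s)).
  rewrite expr2 (comm_mul (VX u (f a)) (VX u (f a))); congr (_ + _).
  rewrite mulrBl mulrBr addrACA -tC -mulr2n mulr_natr; congr (_ + _).
  rewrite mulr_suml mulr_sumr -opprD -big_split/=; congr (- _).
  apply: eq_bigr => s _; rewrite mulrDr; congr (_ + _).
    by rewrite [G s * (_ * _)]mulrA -(tC _ (G s)) !mulrA (coef_swap s).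
  by rewrite mulrA -coefC !mulrA (coef_swap s).
have H : V u * (\sum_a X (f a) ^+ 2) = (\sum_a X (f a) ^+ 2) * V u
    + (X (flat B u) + X (flat B u)).
  rewrite (comm_sum h); congr (_ + _); rewrite sumrB -mulr_suml flat_sum mulr_natr mulr2n.
  rewrite exchange_big/= big1 ?subr0// => s sR.
  rewrite -mulr_sumr big_split/= -mulr_sumr -mulr_suml flat_sum grp_flat//.
  by rewrite mulNr addNr mulr0.
by rewrite /sqnorm mulrA -tC -mulrA H mulrDr mulrA half_double.
Qed.

Definition lapl : A := - (t 2^-1 * \sum_a V (e a) ^+ 2).

Lemma flat_frame a : flat B (e a) = f a.
Proof.
rewrite /flat (bigD1 a)//= frame_covE eqxx scale1r big1 ?addr0// => b ba.
by rewrite frame_covE (negPf ba) scale0r.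
Qed.

(** By [vec_sqnorm] the bracket is the symmetrised Euler element
    (1/2) sum (X V + V X). Reordering V X into X V adds half the trace of the
    defining relation: 2n/2 from the pairing, and - c(s) s for each reflection
    since alpha_s^v takes the value 2 on alpha_s. *)
Lemma sqnorm_lapl : sqnorm * lapl - lapl * sqnorm = euler.
Proof.
have H : (\sum_a V (e a) ^+ 2) * sqnorm = sqnorm * (\sum_a V (e a) ^+ 2) +
    \sum_a (X (f a) * V (e a) + V (e a) * X (f a)).
  rewrite mulr_sumr mulr_suml -big_split/=; apply: eq_bigr => a _.
  have h := vec_sqnorm (e a); rewrite flat_frame in h.
  rewrite expr2 -mulrA h mulrDr mulrA h mulrDl -!mulrA -!addrA.
  by congr (_ + _).
rewrite /lapl mulrN mulNr opprK -(mulrA (t _) _ sqnorm) H mulrDr.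
rewrite (mulrA sqnorm) -(tC _ sqnorm) -(mulrA (t _) sqnorm).
rewrite addrA addNr add0r big_split/=.
under [X in _ + X]eq_bigr => a _ do rewrite VX.
rewrite big_split/= addrA mulrDr half_double /euler -addrA; congr (_ + _).
rewrite sumrB exchange_big/=.
have -> : \sum_a t (f a (e a)) = n%:R + n%:R :> A.
  under eq_bigr do rewrite frame_covE eqxx rmorph1.
  by rewrite sumr_const card_sum card_ord natrD.
have -> : \sum_(s in Refl) \sum_a cc s * t (f a (alpha D s)) * t (coroot D s (e a)) * G s
    = refl_sum + refl_sum.
  rewrite -big_split/=; apply: eq_bigr => s sR; rewrite -mulr_suml -mulrDl.
  congr (_ * _); under eq_bigr do rewrite -mulrA -rmorphM.
  rewrite -mulr_sumr -rmorph_sum.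
  have -> : \sum_a f a (alpha D s) * coroot D s (e a) = 2.
    rewrite -(coroot_alpha sR) {2}[alpha D s](frame_vec_decomp B dimE) linear_sum.
    by apply: eq_bigr => a _; rewrite linearZ.
  by rewrite rmorph_nat mulr_natr mulr2n.
by rewrite mulrBr !half_double.
Qed.

(** The hypothesis says that the rotation p annihilates the quadratic
    form. The reflection terms again pair X_w G_s with G_s X_w, w dual to
    alpha_s, and cancel as in [vec_sqnorm] because the covectors commute. *)
Lemma cov_vec_sqnorm (p : I -> Edual) :
  \sum_a X (p a) * X (f a) = 0 -> cov_vec p * sqnorm = sqnorm * cov_vec p.
Proof.
move=> p0.
have pf a : cov_map p (f a) = p a.
  rewrite /cov_map (bigD1 a)//= frame_covE eqxx scale1r big1 ?addr0// => b ba.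
  by rewrite frame_covE eq_sym (negPf ba) scale0r.
have h a : cov_vec p * X (f a) ^+ 2 = X (f a) ^+ 2 * cov_vec p
    + (X (p a) * X (f a) * 2
    - \sum_(s in Refl) cc s *
       (X (cov_map p (coroot D s)) * (G s * (t (f a (alpha D s)) * X (f a))) +
        (t (f a (alpha D s)) * X (f a)) * (X (cov_map p (coroot D s)) * G s))).
  rewrite expr2 (comm_mul (cov_vec_comm p (f a)) (cov_vec_comm p (f a))).
  congr (_ + _); rewrite pf mulrBl mulrBr addrACA [X (f a) * X (p a)]XC -mulr2n mulr_natr.
  congr (_ + _); rewrite mulr_suml mulr_sumr -opprD -big_split/=; congr (- _).
  apply: eq_bigr => s _; rewrite mulrDr; congr (_ + _).
    rewrite [G s * (_ * _)]mulrA -(tC _ (G s)) !mulrA; do 2!congr (_ * _).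
    by rewrite -!mulrA; congr (_ * _); rewrite tC.
  rewrite !mulrA -ccC; do 2!congr (_ * _).
  by rewrite -!mulrA; congr (_ * _); rewrite tC.
have H : cov_vec p * (\sum_a X (f a) ^+ 2) = (\sum_a X (f a) ^+ 2) * cov_vec p.
  rewrite (comm_sum h) sumrB -mulr_suml p0 mul0r exchange_big/=.
  rewrite [X in _ + (_ - X)]big1 ?subr0 ?addr0// => s sR.
  rewrite -mulr_sumr big_split/= -!mulr_sumr -mulr_suml flat_sum grp_flat//.
  by rewrite mulNr mulrN !mulrA [X (flat _ _) * _]XC addNr mulr0.
by rewrite /sqnorm mulrA -tC -mulrA H mulrA.
Qed.

End CherednikRelations.

(** An anti-involution exchanging e_+ and - e_- and fixing z transports
    the brackets with e_+ to those with e_-. *)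
Section StarConsequences.
Context {A : pzRingType} (star : A -> A) (ep em h z : A).
Hypothesis starD : forall a b, star (a + b) = star a + star b.
Hypothesis starN : forall a, star (- a) = - star a.
Hypothesis starM : forall a b, star (a * b) = star b * star a.
Hypotheses (star_ep : star ep = - em) (star_em : star em = - ep).
Hypothesis star_z : star z = z.
Hypothesis ep_em : ep * em - em * ep = h.
Hypothesis h_ep : h * ep - ep * h = ep *+ 2.
Hypothesis z_ep : z * ep = ep * z.

Lemma star_bracket : star h = h.
Proof. by rewrite -ep_em starD starN !starM star_ep star_em !mulrNN. Qed.

Lemma star_weight : h * em - em * h = - (em *+ 2).
Proof.
have := congr1 star h_ep.
rewrite mulr2n !starD starN !starM star_bracket star_ep mulNr mulrN opprK addrC.
by rewrite mulr2n opprD.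
Qed.

Lemma star_central : z * em = em * z.
Proof.
have := congr1 star z_ep; rewrite !starM star_z star_ep mulNr mulrN.
by move/oppr_inj.
Qed.

Lemma central_bracket : z * h = h * z.
Proof.
by rewrite -ep_em mulrBr mulrBl !mulrA z_ep star_central -!mulrA z_ep star_central.
Qed.

End StarConsequences.

(** * The copy of u(1,1) in the rational Cherednik algebra *)

Section QalgRel.
Context (K : comNzRingType) (A : algType K) (S : set A).
Implicit Types p q : A.
Local Notation pi p := (qpi (two_sided S) p : qalg S).

Lemma qalg_rel p q : S (p - q) -> pi p = pi q.
Proof.
move=> pq; apply/qpi_eq/mem_lspan; exists 1, (p - q), 1.
by rewrite mul1r mulr1.
Qed.

Lemma qalg_relM p q p' q' : S (p * q - p' * q') -> pi p * pi q = pi p' * pi q'.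
Proof. by move=> /qalg_rel; rewrite !qpi_algM. Qed.

Lemma qalg_relP p a q r : S (p - (a *: q + r)) -> pi p = a *: pi q + pi r.
Proof. by move=> /qalg_rel; rewrite linearP. Qed.

Lemma qalg_rel_comm p q a (J : finType) (P : pred J) (c : J -> K) (r : J -> A) :
  S (p * q - q * p - (a%:A - \sum_(j | P j) c j *: r j)) ->
  pi p * pi q = pi q * pi p + (a *: (1 : qalg S) - \sum_(j | P j) c j *: pi (r j)).
Proof.
move=> /qalg_rel; rewrite !linearB/= !qpi_algM linearZ linear_sum/= => h.
rewrite [LHS](canRL (subrK _) h) addrC; congr (_ + (_ - _)).
by apply: eq_bigr => j _; rewrite linearZ.
Qed.
End QalgRel.

Section ConjLinear.
Context {K : numClosedFieldType} {U : lmodType K} (f : U -> U).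
Hypothesis lin : forall a u v, f (a *: u + v) = Num.conj a *: f u + f v.

Lemma conj_linearD u v : f (u + v) = f u + f v.
Proof. by have := lin 1 u v; rewrite rmorph1 !scale1r. Qed.

Lemma conj_linear0 : f 0 = 0.
Proof. by apply: (addIr (f 0)); rewrite -conj_linearD !add0r. Qed.

Lemma conj_linearZ a u : f (a *: u) = Num.conj a *: f u.
Proof. by have := lin a u 0; rewrite conj_linear0 !addr0. Qed.

Lemma conj_linearN u : f (- u) = - f u.
Proof. by rewrite -scaleN1r conj_linearZ rmorphN rmorph1 scaleN1r. Qed.

Lemma conj_linear_sum (J : finType) (u : J -> U) : f (\sum_j u j) = \sum_j f (u j).
Proof.
by elim/big_rec2: _ => [|j x y _ <-]; rewrite ?conj_linear0 ?conj_linearD.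
Qed.
End ConjLinear.

Section ToCx.
Context {R : realType}.

Lemma toCx_zmod : zmod_morphism (@toCx R).
Proof. by move=> r r'; exact: (rmorphB (real_complex R)). Qed.
HB.instance Definition _ := GRing.isZmodMorphism.Build R (Cx R) (@toCx R) toCx_zmod.

Lemma toCx_monoid : monoid_morphism (@toCx R).
Proof.
split=> [|r r']; first exact: (rmorph1 (real_complex R)).
exact: (rmorphM (real_complex R)).
Qed.
HB.instance Definition _ := GRing.isMonoidMorphism.Build R (Cx R) (@toCx R) toCx_monoid.

End ToCx.

Section Rca.
Context {R : realType} {E : vectType R} {gT : finGroupType}.
Variable D : reflection_datum E gT.
Local Notation C := (Cx R).
Local Notation Edual := 'Hom(E, R^o).
Local Notation Refl := (reflections (rho D)).
Local Notation X := (rca_cov D).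
Local Notation V := (rca_vec D).
Local Notation G := (rca_grp D).
Implicit Types (x y : Edual) (xi eta : E) (g : gT) (h k : rca D).

Lemma rca_scalerAl (a : C) h k : a *: (h * k) = (a *: h) * k.
Proof. exact: qalg_scalerAl. Qed.

Lemma rca_covP (r : R) x y : X (r *: x + y) = toCx r *: X x + X y.
Proof. exact: (qalg_relP (RcaCovLin D r x y)). Qed.

Lemma rca_grp_cov g x : G g * X x = X (dual_action (rho D) g x) * G g.
Proof. exact: qalg_relM (RcaGrpCov D g x). Qed.

Lemma rca_covC x y : X x * X y = X y * X x.
Proof. exact: qalg_relM (RcaCovC D x y). Qed.

Lemma rca_vec_cov xi x : V xi * X x = X x * V xi + (toCx (x xi) *: (1 : rca D)
  - \sum_(s in Refl) (toCx (x (alpha D s) * coroot D s xi) * cpar D s) *: G s).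
Proof. exact: qalg_rel_comm (RcaVecCov D xi x). Qed.

Lemma rca_cov_sum (I : finType) (r : I -> R) (v : I -> Edual) :
  X (\sum_i r i *: v i) = \sum_i toCx (r i) *: X (v i).
Proof.
elim/big_rec2: _ => [|i u w _ <-]; last by rewrite rca_covP.
have := rca_covP 1 0 0; rewrite scaler0 addr0 rmorph1 scale1r => h.
by apply: (addrI (X 0)); rewrite addr0 -h.
Qed.

End Rca.

Section Transfer.
Context {R : realType} {E : vectType R} {gT : finGroupType}.
Context {D : reflection_datum E gT} {n : nat} (B : complex_frame D n).
Hypothesis dimE : \dim {:E} = (2 * n)%N.
Local Notation C := (Cx R).
Local Notation X := (rca_cov D).
Local Notation V := (rca_vec D).
Local Notation G := (rca_grp D).
Local Notation Refl := (reflections (rho D)).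

(** The Cherednik algebra contains the real scalars centrally, which
    brings it under the ring-theoretic computations above. *)
Definition rca_real (r : R) : rca D := toCx r *: (1 : rca D).

Lemma rca_scaleE (c : C) (h : rca D) : c *: h = (c *: (1 : rca D)) * h.
Proof. by rewrite -rca_scalerAl mul1r. Qed.

Lemma rca_scalarC (c : C) (h : rca D) : (c *: (1 : rca D)) * h = h * (c *: (1 : rca D)).
Proof. by rewrite -rca_scalerAl mul1r -rca_scalerAr mulr1. Qed.

Lemma rca_scalarM (a b : C) :
  (a *: (1 : rca D)) * (b *: (1 : rca D)) = (a * b) *: (1 : rca D).
Proof. by rewrite -rca_scaleE scalerA. Qed.

Lemma rca_real_zmod : zmod_morphism rca_real.
Proof. by move=> r r'; rewrite /rca_real rmorphB scalerBl. Qed.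
HB.instance Definition _ := GRing.isZmodMorphism.Build R (rca D) rca_real rca_real_zmod.

Lemma rca_real_monoid : monoid_morphism rca_real.
Proof.
split; first by rewrite /rca_real rmorph1 scale1r.
by move=> r r'; rewrite /rca_real rmorphM rca_scalarM.
Qed.
HB.instance Definition _ :=
  GRing.isMonoidMorphism.Build R (rca D) rca_real rca_real_monoid.

Let cc (s : gT) : rca D := cpar D s *: (1 : rca D).

Let tC r (a : rca D) : rca_real r * a = a * rca_real r. Proof. exact: rca_scalarC. Qed.
Let ccC s (a : rca D) : cc s * a = a * cc s. Proof. exact: rca_scalarC. Qed.
Let X_sum (J : finType) (r : J -> R) (v : J -> 'Hom(E, R^o)) :
  X (\sum_i r i *: v i) = \sum_i rca_real (r i) * X (v i).
Proof. by rewrite rca_cov_sum; apply: eq_bigr => i _; rewrite rca_scaleE. Qed.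
Let VX u x : V u * X x = X x * V u + (rca_real (x u)
  - \sum_(s in Refl) cc s * rca_real (x (alpha D s)) * rca_real (coroot D s u) * G s).
Proof.
rewrite rca_vec_cov; congr (_ + (_ - _)); apply: eq_bigr => s _.
rewrite [LHS]rca_scaleE; congr (_ * G s).
rewrite /cc /rca_real !rca_scalarM (rmorphM (@toCx R)); congr (_ *: (1 : rca D)).
by rewrite [LHS]mulrC mulrA.
Qed.

Lemma toCxV2 : toCx (2^-1 : R) = 2^-1.
Proof. by rewrite fmorphV rmorph_nat. Qed.

Lemma rca_EpE : rca_Ep B = sqnorm B rca_real X.
Proof.
rewrite /rca_Ep /sqnorm rca_scaleE -toCxV2; congr (_ * _).
by rewrite [RHS]big_sumType/= big_split.
Qed.

Lemma rca_EmE : rca_Em B = lapl B rca_real V.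
Proof.
rewrite /rca_Em /lapl rca_scaleE -toCxV2; congr (- (_ * _)).
by rewrite [RHS]big_sumType/= big_split.
Qed.

Lemma rca_HE : rca_H B = euler B cc X V G.
Proof.
rewrite /rca_H /euler /cov_vec big_sumType/= big_split; congr (_ + _ - _).
by apply: eq_bigr => s _; rewrite rca_scaleE.
Qed.

(* (x_j, y_j) |-> (- y_j, x_j): the complex structure on the frame of the dual *)
Let zcov (a : 'I_n + 'I_n) := match a with inl j => - yy B j | inr j => xx B j end.

Let covN x : X (- x) = - X x.
Proof. exact: (cov_opp B dimE X_sum). Qed.

Lemma rca_Z0E : rca_Z0 B = iCx R *: cov_vec B X V zcov.
Proof.
congr (_ *: _); rewrite /cov_vec [RHS]big_sumType [RHS]addrC -[RHS]big_split.
by apply: eq_bigr => j _; congr (_ + _); rewrite /= covN mulNr.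
Qed.

Lemma rca_H_cov x : rca_H B * X x = X x * rca_H B + X x.
Proof.
rewrite rca_HE.
exact: (euler_comm B dimE tC ccC X_sum (@rca_covC _ _ _ D) (@rca_grp_cov _ _ _ D) VX).
Qed.

Lemma rca_H_Ep : rca_H B * rca_Ep B - rca_Ep B * rca_H B = rca_Ep B *+ 2.
Proof.
rewrite rca_HE rca_EpE.
exact: (euler_sqnorm B dimE tC ccC X_sum (@rca_covC _ _ _ D) (@rca_grp_cov _ _ _ D) VX).
Qed.

Lemma rca_EpEm : rca_Ep B * rca_Em B - rca_Em B * rca_Ep B = rca_H B.
Proof.
rewrite rca_HE rca_EpE rca_EmE.
exact: (sqnorm_lapl B dimE tC ccC X_sum (@rca_grp_cov _ _ _ D) VX).
Qed.

Lemma rca_Z0_Ep : rca_Z0 B * rca_Ep B = rca_Ep B * rca_Z0 B.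
Proof.
have zz : \sum_a X (zcov a) * X (frame_cov B a) = 0.
  rewrite [LHS]big_sumType -[LHS]big_split; apply: big1 => j _.
  by rewrite /= covN mulNr (rca_covC D (yy B j)) addNr.
have q := cov_vec_sqnorm dimE tC ccC X_sum
  (@rca_covC _ _ _ D) (@rca_grp_cov _ _ _ D) VX zz.
rewrite rca_Z0E rca_EpE.
exact: etrans (esym (rca_scalerAl _ _ _)) (etrans (congr1 _ q) (rca_scalerAr _ _ _)).
Qed.

Section Star.
Variable star : rca D -> rca D.
Hypothesis starP : is_rca_star B star.

Let lin := let: And5 lin _ _ _ _ := starP in lin.
Lemma starD h k : star (h + k) = star h + star k.
Proof. exact: conj_linearD lin h k. Qed.
Lemma starN h : star (- h) = - star h.
Proof. exact: conj_linearN lin h. Qed.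
Lemma starM h k : star (h * k) = star k * star h.
Proof. by have [_ [_ sM] _ _ _] := starP. Qed.

Lemma star_Ep : star (rca_Ep B) = - rca_Em B.
Proof.
have [_ _ _ sx _] := starP.
rewrite /rca_Ep /rca_Em (conj_linearZ lin) (conj_linear_sum lin) fmorphV rmorph_nat.
apply: etrans (esym (opprK _)); congr (_ *: _); apply: eq_bigr => j _.
have [_ sX _ sY] := sx j; apply: etrans (starD _ _) _.
by congr (_ + _); apply: etrans (starM _ _) _; rewrite ?sX ?sY.
Qed.

Lemma star_Em : star (rca_Em B) = - rca_Ep B.
Proof.
have [_ _ sK _ _] := starP; have := sK (rca_Ep B); rewrite star_Ep starN => h.
exact: etrans (esym (opprK _)) (congr1 -%R h).
Qed.

Lemma star_H : star (rca_H B) = rca_H B.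
Proof. exact: star_bracket starD starN starM star_Ep star_Em rca_EpEm. Qed.

Lemma star_Z0 : star (rca_Z0 B) = rca_Z0 B.
Proof.
have [_ _ _ sx _] := starP.
rewrite /rca_Z0 (conj_linearZ lin) (conj_linear_sum lin) conjCi scaleNr -scalerN -sumrN.
congr (_ *: _); apply: eq_bigr => j _; have [sV sX sW sY] := sx j.
have sa := etrans (starM (X (xx B j)) (V (veta B j))) (congr2 *%R sW sX).
have sb := etrans (starM (X (yy B j)) (V (vxi B j))) (congr2 *%R sV sY).
have sab := etrans (starD _ _) (congr2 +%R sa (etrans (starN _) (congr1 -%R sb))).
exact: etrans (congr1 -%R sab) (opprB _ _).
Qed.

Lemma rca_H_Em : rca_H B * rca_Em B - rca_Em B * rca_H B = - (rca_Em B *+ 2).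
Proof. exact: star_weight starD starN starM star_Ep star_Em rca_EpEm rca_H_Ep. Qed.

Lemma rca_Z0_Em : rca_Z0 B * rca_Em B = rca_Em B * rca_Z0 B.
Proof. exact: star_central starM star_Ep star_Z0 rca_Z0_Ep. Qed.

Lemma rca_Z0_H : rca_Z0 B * rca_H B = rca_H B * rca_Z0 B.
Proof. exact: central_bracket starM star_Ep star_Z0 rca_EpEm rca_Z0_Ep. Qed.

End Star.
End Transfer.

(** * Lowest weight modules of u(1,1) *)

Section U11Theory.
Context {K : numFieldType} (W : u11_module K).
Local Notation Ep := (u11_Ep W).
Local Notation Em := (u11_Em W).
Local Notation H := (u11_H W).
Local Notation Z := (u11_Z W).
Implicit Types (w u v : W) (q p : {poly K}) (i j m : nat).

(** Polynomials in E_+ applied to w. When w is a lowest weight vector,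
    E_-, H and Z act on these by the operators [lw_Em_poly], [lw_H_poly] and a
    scalar on q, which do not depend on the module. *)
Definition u11_ev (w : W) (q : {poly K}) : W :=
  \sum_(i < size q) q`_i *: iter i Ep w.

Lemma u11_ev_widen w q m : (size q <= m)%N ->
  u11_ev w q = \sum_(i < m) q`_i *: iter i Ep w.
Proof.
move=> qm; rewrite /u11_ev (big_ord_widen m (fun i => q`_i *: iter i Ep w) qm).
rewrite [RHS](bigID (fun i : 'I_m => (i < size q)%N)) /= [X in _ = _ + X]big1 ?addr0//.
by move=> i; rewrite -leqNgt => h; rewrite nth_default// scale0r.
Qed.

Lemma u11_ev_linear w : linear (u11_ev w).
Proof.
move=> a p q; pose m := maxn (size p) (size q).
rewrite (@u11_ev_widen w p m) ?leq_maxl// (@u11_ev_widen w q m) ?leq_maxr//.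
rewrite (@u11_ev_widen w _ m); last first.
  rewrite (leq_trans (size_polyD _ _))// geq_max leq_maxr andbT.
  by rewrite (leq_trans (size_scale_leq _ _))// leq_maxl.
rewrite scaler_sumr -big_split; apply: eq_bigr => i _.
by rewrite coefD coefZ scalerDl scalerA.
Qed.
HB.instance Definition _ w :=
  GRing.isLinear.Build K {poly K} W _ (u11_ev w) (u11_ev_linear w).

Lemma iter_linear (V : lmodType K) (T : {linear V -> V}) i : linear (iter i T).
Proof. by elim: i => // i IH a u v /=; rewrite IH linearP. Qed.

Lemma iter_linear0 (V : lmodType K) (T : {linear V -> V}) i : iter i T 0 = 0.
Proof. by elim: i => // i IH; rewrite iterS IH linear0. Qed.

Lemma iter_linearZ (V : lmodType K) (T : {linear V -> V}) i a (x : V) :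
  iter i T (a *: x) = a *: iter i T x.
Proof. by have := iter_linear T i a x 0; rewrite iter_linear0 !addr0. Qed.

Lemma u11_ev_linearl q : linear (u11_ev^~ q).
Proof.
move=> a v w; rewrite /u11_ev scaler_sumr -big_split; apply: eq_bigr => i _.
by rewrite iter_linear scalerDr !scalerA mulrC.
Qed.

Lemma u11_evXn w i : u11_ev w 'X^i = iter i Ep w.
Proof.
rewrite (@u11_ev_widen w _ i.+1) ?size_polyXn// (bigD1 ord_max)//=.
rewrite coefXn eqxx scale1r big1 ?addr0// => j ji; rewrite coefXn.
have -> : (j == i :> nat) = false by apply: contraNF ji => /eqP ji; apply/eqP/val_inj.
by rewrite scale0r.
Qed.

Lemma u11_ev_Ep w q : Ep (u11_ev w q) = u11_ev w (q * 'X).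
Proof.
rewrite (@u11_ev_widen w (q * 'X) (size q).+1); last first.
  by rewrite (leq_trans (size_polyMleq _ _))// size_polyX addnC.
rewrite big_ord_recl coefMX scale0r add0r linear_sum; apply: eq_bigr => i _.
by rewrite linearZ /= coefMX.
Qed.

Lemma u11_ev_shift w q j : u11_ev (iter j Ep w) q = u11_ev w (q * 'X^j).
Proof.
elim: j q => [|j IH] q; first by rewrite mulr1.
rewrite exprS mulrA -IH -u11_ev_Ep linear_sum; apply: eq_bigr => i _.
by rewrite linearZ /= -iterSr.
Qed.

Lemma u11_Em_Ep u : Em (Ep u) = Ep (Em u) - H u.
Proof. by rewrite -u11_EpEm opprB addrC subrK. Qed.

Lemma u11_H_Ep u : H (Ep u) = Ep (H u) + 2 *: Ep u.
Proof. by rewrite -u11_HEp addrC subrK. Qed.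

Lemma u11_Z_iter nu w i : Z w = nu *: w -> Z (iter i Ep w) = nu *: iter i Ep w.
Proof. by move=> Zw; elim: i => // i IH; rewrite iterS u11_ZEp IH linearZ. Qed.

Lemma u11_ev_Z nu w q : Z w = nu *: w -> Z (u11_ev w q) = nu *: u11_ev w q.
Proof.
move=> Zw; rewrite linear_sum scaler_sumr; apply: eq_bigr => i _.
by rewrite linearZ /= (u11_Z_iter i Zw) !scalerA mulrC.
Qed.

Section WeightVector.
Variables (mu : K) (w : W).
Hypotheses (Ew : Em w = 0) (Hw : H w = mu *: w).

Lemma u11_H_iter i : H (iter i Ep w) = (mu + i.*2%:R) *: iter i Ep w.
Proof.
elim: i => [|i IH]; first by rewrite addr0.
rewrite iterS u11_H_Ep IH linearZ /= -scalerDl -mul2n -[(i.+1).*2]mul2n !natrM -natr1.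
by congr (_ *: _); ring.
Qed.

Lemma u11_Em_iter i :
  Em (iter i.+1 Ep w) = - (i.+1%:R * (mu + i%:R)) *: iter i Ep w.
Proof.
elim: i => [|i IH].
  by rewrite /= u11_Em_Ep Ew linear0 sub0r Hw mul1r addr0 scaleNr.
rewrite iterS u11_Em_Ep IH linearZ u11_H_iter -scalerBl /= -mul2n !natrM.
by congr (_ *: _); rewrite -!natr1; ring.
Qed.

Lemma u11_ev_Em q : Em (u11_ev w q) = u11_ev w (lw_Em_poly mu q).
Proof.
rewrite (@u11_ev_widen w q (size q).+1)// big_ord_recl linearD linearZ /= Ew.
rewrite scaler0 add0r (@u11_ev_widen w (lw_Em_poly mu q) (size q)) ?size_poly//.
rewrite linear_sum; apply: eq_bigr => i _.
by rewrite linearZ (u11_Em_iter i) coef_lw_Em /= scalerA; congr (_ *: _); ring.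
Qed.

Lemma u11_ev_H q : H (u11_ev w q) = u11_ev w (lw_H_poly mu q).
Proof.
rewrite (@u11_ev_widen w (lw_H_poly mu q) (size q)) ?size_poly//.
rewrite linear_sum; apply: eq_bigr => i _.
by rewrite linearZ /= (u11_H_iter i) coef_lw_H scalerA mulrC.
Qed.

(** The scalar by which E_-^i E_+^i acts on a lowest weight vector. *)
Definition u11_norm (i : nat) : K := \prod_(j < i) - (j.+1%:R * (mu + j%:R)).

Lemma u11_Em_iter_iter i : iter i Em (iter i Ep w) = u11_norm i *: w.
Proof.
elim: i => [|i IH]; first by rewrite /u11_norm big_ord0 scale1r.
rewrite iterSr u11_Em_iter iter_linearZ IH scalerA /u11_norm big_ord_recr /=.
by rewrite [in RHS]mulrC.
Qed.

Lemma u11_norm_eq0 i : (u11_norm i == 0) = lw_null mu i.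
Proof.
rewrite /u11_norm prodf_seq_eq0; apply/hasP/existsP => [[j _]|[j hj]].
  by rewrite /= oppr_eq0 mulf_eq0 pnatr_eq0 => h; exists j.
by exists j; rewrite ?mem_index_enum//= (eqP hj) mulr0 oppr0.
Qed.

(** The vectors E_+^i w have distinct H-eigenvalues mu + 2i. *)
Lemma u11_ev_eq0 q : u11_ev w q = 0 -> forall i, q`_i *: iter i Ep w = 0.
Proof.
move=> q0 i; have [qi|qi] := leqP (size q) i; first by rewrite nth_default ?scale0r.
have := @eigen_indep _ _ H _ (index_enum 'I_(size q))
  (fun i : 'I_(size q) => q`_i *: iter i Ep w)
  (fun i : 'I_(size q) => mu + i.*2%:R)
  (index_enum_uniq _) _ _ q0 (Ordinal qi) (mem_index_enum _).
apply.
  move=> j k _ _ /addrI/eqP; rewrite eqr_nat => /eqP jk.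
  by apply/val_inj/double_inj.
by move=> j _; rewrite linearZ /= (u11_H_iter j) !scalerA mulrC.
Qed.

End WeightVector.

Section IrreducibleLowestWeight.
Variables (mu nu : K) (v0 : W).
Hypotheses (irr : u11_irreducible W) (lw : u11_lowest_weight mu nu v0).

Let v00 : v0 != 0. Proof. by case: lw. Qed.
Let Em0 : Em v0 = 0. Proof. by case: lw. Qed.
Let H0 : H v0 = mu *: v0. Proof. by case: lw. Qed.
Let Z0 : Z v0 = nu *: v0. Proof. by case: lw. Qed.

(** For u killed by E_- and an eigenvector of H and Z, the polynomials in
    E_+ applied to u form a submodule. *)
Lemma u11_generated mu' u : Em u = 0 -> H u = mu' *: u -> Z u = nu *: u ->
  u != 0 -> forall v, exists q, v = u11_ev u q.
Proof.
move=> Eu Hu Zu u0; pose U : {pred W} := fun v => `[< exists q, v = u11_ev u q >].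
have UC : submod_closed U.
  split; first by apply/asboolP; exists 0; rewrite linear0.
  move=> a x y /asboolP[p ->] /asboolP[q ->]; apply/asboolP.
  by exists (a *: p + q); rewrite linearP.
pose US := HB.pack_for (submodClosed W) U (GRing.isSubmodClosed.Build K W U UC).
have [|U0|UT] := irr.2 US.
- move=> v /asboolP[q ->]; split; apply/asboolP.
  + by exists (q * 'X); rewrite u11_ev_Ep.
  + by exists (lw_Em_poly mu' q); rewrite (u11_ev_Em Eu Hu).
  + by exists (lw_H_poly mu' q); rewrite (u11_ev_H Hu).
  + by exists (nu *: q); rewrite (u11_ev_Z _ Zu) linearZ.
- suff uU : u \in US by rewrite (U0 u uU) eqxx in u0.
  by apply/asboolP; exists 'X^0; rewrite u11_evXn.
- by move=> v; exact/asboolP/UT.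
Qed.

Lemma u11_irr_generated v : exists q, v = u11_ev v0 q.
Proof. exact: u11_generated Em0 H0 Z0 v00 v. Qed.

(** If mu + j = 0 then u = E_+^(j+1) v_0 is killed by E_-. If it were
    nonzero it would generate the module, and v_0 would be a combination of
    vectors of strictly larger weight. *)
Lemma u11_irr_null i : lw_null mu i -> iter i Ep v0 = 0.
Proof.
case/existsP => j /eqP hj; set u := iter j.+1 Ep v0.
suff u0 : u = 0.
  rewrite -(subnK (ltn_ord j)) iterD -/u u0.
  exact: iter_linear0.
apply: contrapT => /eqP u0.
have Eu : Em u = 0 by rewrite (u11_Em_iter Em0 H0) hj mulr0 oppr0 scale0r.
have [q vq] := u11_generated Eu (u11_H_iter H0 _) (u11_Z_iter _ Z0) u0 v0.
have : u11_ev v0 ('X^0 - q * 'X^(j.+1)) = 0.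
  by rewrite linearB /= u11_evXn -u11_ev_shift -vq subrr.
move/(u11_ev_eq0 H0)/(_ 0%N); rewrite coefB coefXn coefMXn subr0 scale1r /= => v0_0.
by move: v00; rewrite v0_0 eqxx.
Qed.

Lemma u11_irr_nullE i : (iter i Ep v0 == 0) = lw_null mu i.
Proof.
apply/eqP/idP => [h|]; last exact: u11_irr_null.
rewrite -u11_norm_eq0; have := u11_Em_iter_iter Em0 H0 i; rewrite h.
rewrite iter_linear0.
by move/esym/eqP; rewrite scaler_eq0 (negPf v00) orbF.
Qed.

End IrreducibleLowestWeight.
End U11Theory.

(** * Self-adjoint operators for a positive definite form *)

Lemma submodB (K : pzRingType) (V : lmodType K) (U : submodClosed V) u v :
  u \in U -> v \in U -> u - v \in U.
Proof. by move=> uU vU; rewrite -scaleN1r rpredD ?rpredZ. Qed.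

Lemma submodP (K : pzRingType) (V : lmodType K) (U : submodClosed V) a u v :
  u \in U -> v \in U -> a *: u + v \in U.
Proof. by move=> uU vU; rewrite rpredD ?rpredZ. Qed.

Definition finitely_spanned (K : pzRingType) (V : lmodType K) (F : {pred V}) : Prop :=
  exists d (s : 'I_d.+1 -> V), (forall i, s i \in F) /\
    forall u, u \in F -> exists r : 'rV[K]_d.+1, u = \sum_i r 0 i *: s i.

Section SelfAdjoint.
Context {K : numClosedFieldType} {V : lmodType K}.
Variable beta : {hermitian_sym V for Num.conj}.
Hypothesis beta_pos : forall v, v != 0 -> 0 < beta v v.

Lemma beta_eq0 v : beta v v = 0 -> v = 0.
Proof.
by move=> v0; apply: contrapT => /eqP/beta_pos; rewrite v0 ltxx.
Qed.

Lemma beta_sym0 u v : beta u v = 0 -> beta v u = 0.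
Proof. by move=> uv; rewrite hermC uv rmorph0 mulr0. Qed.

(** Pairing the relation with w_i leaves only the norm of w_i. *)
Lemma orth_indep (I : eqType) (s : seq I) (w : I -> V) : uniq s ->
  (forall i j, i \in s -> j \in s -> i != j -> beta (w i) (w j) = 0) ->
  \sum_(i <- s) w i = 0 -> forall i, i \in s -> w i = 0.
Proof.
move=> us orth sw0 i is_; apply: beta_eq0.
have := linear0l beta (w i); rewrite -{1}sw0 linear_sumlz (bigD1_seq i)//=.
rewrite big_seq_cond big1 ?addr0// => j /andP[js ji].
exact: orth.
Qed.

Variable T : {linear V -> V}.
Hypothesis T_adj : forall u v, beta (T u) v = beta u (T v).

(** The eigenvalue b is real because v may be assumed nonzero. *)
Lemma selfadj_orth a b u v : T u = a *: u -> T v = b *: v -> a != b ->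
  beta u v = 0.
Proof.
move=> Tu Tv ab; have [->|v0] := eqVneq v 0; first by rewrite linear0r.
have bR : Num.conj b = b.
  have := T_adj v v; rewrite Tv linearZl_LR linearZr_LR /= => /esym.
  by move/(mulIf _) => -> //; rewrite gt_eqF ?beta_pos.
have := T_adj u v; rewrite Tu Tv linearZl_LR linearZr_LR /= bR => /eqP.
by rewrite -subr_eq0 -mulrBl mulf_eq0 subr_eq0 (negPf ab) => /eqP.
Qed.

(** Generalised eigenvectors are the vectors killed by a power of this
    map. *)
Definition eigen_defect a v : V := T v - a *: v.

Lemma eigen_defect_linear a : linear (eigen_defect a).
Proof.
move=> b u v; rewrite /eigen_defect linearP scalerBr scalerDr opprD.
by rewrite addrACA !scalerA mulrC.
Qed.
HB.instance Definition _ a :=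
  GRing.isLinear.Build K V V _ (eigen_defect a) (eigen_defect_linear a).

Lemma eigen_defect_eq0 a v : eigen_defect a v = 0 <-> T v = a *: v.
Proof. by rewrite /eigen_defect; split=> [/subr0_eq//|->]; exact: subrr. Qed.

(** There are no Jordan blocks: w = (T - a) m is an eigenvector, so either
    w = 0 or a is real; in the latter case <w, w> = <m, (T - a) w> = 0. *)
Lemma selfadj_defect_sq a m :
  eigen_defect a (eigen_defect a m) = 0 -> eigen_defect a m = 0.
Proof.
set w := eigen_defect a m => /eigen_defect_eq0 Tw; apply: beta_eq0.
have aw : (a - Num.conj a) * beta w w = 0.
  have := T_adj w w; rewrite Tw linearZl_LR linearZr_LR /= => aw.
  by rewrite mulrBl aw subrr.
have ww : beta w w = (Num.conj a - a) * beta m w.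
  rewrite {1}/w /eigen_defect linearBl /= linearZl_LR /= T_adj Tw linearZr_LR /=.
  by rewrite mulrBl.
move/eqP: aw; rewrite mulf_eq0 => /orP[|/eqP//].
by rewrite -oppr_eq0 opprB ww => /eqP ->; rewrite mul0r.
Qed.

Definition eigenvectors (U : {pred V}) : set V :=
  [set v | v \in U /\ exists a, T v = a *: v].

(** T - a maps the span of the eigenvectors onto itself up to eigenvectors
    with eigenvalue a, on which it vanishes. *)
Lemma eigenspan_defect (U : submodClosed V) a z : z \in lspan (eigenvectors U) ->
  exists2 y, y \in lspan (eigenvectors U) &
    eigen_defect a (eigen_defect a y - z) = 0.
Proof.
move: z; apply: lspan_ind.
- by exists 0; rewrite ?rpred0// linear0 subr0 linear0.
- move=> b u v [y ys yE] [y' ys' yE']; exists (b *: y + y').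
    by rewrite rpredD ?rpredZ.
  rewrite [eigen_defect a (b *: y + _)]linearP opprD addrACA -scalerBr.
  by rewrite linearP /= yE yE' scaler0 addr0.
- move=> u [uU [b Tu]]; have [ba|ba] := eqVneq b a.
    exists 0; first exact: rpred0.
    rewrite linear0 sub0r linearN /= (_ : eigen_defect a u = 0) ?oppr0//.
    by apply/eigen_defect_eq0; rewrite Tu ba.
  exists ((b - a)^-1 *: u).
    by rewrite rpredZ// mem_lspan//; split=> //; exists b.
  rewrite (_ : eigen_defect a (_ *: u) = u) ?subrr ?linear0//.
  rewrite linearZ /= /eigen_defect Tu -scalerBl scalerA mulVf ?subr_eq0// scale1r//.
Qed.

Section Spectral.
Variable U : submodClosed V.
Hypothesis TU : forall u, u \in U -> T u \in U.

Lemma eigen_defect_in a u : u \in U -> eigen_defect a u \in U.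
Proof. by move=> uU; rewrite /eigen_defect submodB ?rpredZ ?TU. Qed.

Lemma eigenvectors_in u : u \in lspan (eigenvectors U) -> u \in U.
Proof. by apply: (lspan_sub (U := U)) => v []. Qed.

(** Correcting m by the preimage of (T - a) m from [eigenspan_defect]
    leaves a vector killed by (T - a)^2, hence an eigenvector. *)
Lemma eigenspan_of_defect a m : m \in U ->
  eigen_defect a m \in lspan (eigenvectors U) -> m \in lspan (eigenvectors U).
Proof.
move=> mU /(@eigenspan_defect U a)[y ys yE].
have my : eigen_defect a (m - y) = 0.
  apply: selfadj_defect_sq.
  have -> : eigen_defect a (m - y) = - (eigen_defect a y - eigen_defect a m).
    by rewrite [RHS]opprB; exact: linearB.
  by rewrite linearN /= yE oppr0.
rewrite -[m](subrK y) rpredD// mem_lspan//; split.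
  by rewrite submodB// eigenvectors_in.
by exists a; apply/eigen_defect_eq0.
Qed.

(** By Cayley-Hamilton some product of factors T - a vanishes on the
    finitely spanned F; the factors are removed one at a time by
    [eigenspan_of_defect], which keeps all vectors in U. *)
Lemma selfadj_eigenspan (F : {pred V}) : finitely_spanned F ->
  (forall u, u \in F -> T u \in F) -> {subset U <= F} ->
  forall u, u \in U -> u \in lspan (eigenvectors U).
Proof.
move=> [d [s [sF Fs]]] TF UF.
pose phi (r : 'rV[K]_d.+1) := \sum_i r 0 i *: s i.
(* T in coordinates: row vectors of coefficients are multiplied by A *)
have [A AE] : exists A : 'M[K]_d.+1, forall i, T (s i) = phi (row i A).
  have [r rE] := choice (fun i => Fs _ (TF _ (sF i))).
  exists (\matrix_i r i) => i; rewrite rE /phi.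
  by apply: eq_bigr => j _; rewrite rowK.
have phiP a r r' : phi (a *: r + r') = a *: phi r + phi r'.
  rewrite scaler_sumr -big_split; apply: eq_bigr => i _.
  by rewrite !mxE scalerDl scalerA.
have Tphi r : T (phi r) = phi (r *m A).
  rewrite linear_sum mulmx_sum_row; elim/big_rec2: _ => [|i v w _ h].
    by rewrite /phi big1// => i _; rewrite mxE scale0r.
  by rewrite phiP linearZ /= AE h.
have key (l : seq K) r : phi r \in U ->
    phi (r *m \prod_(a <- l) (A - a%:M)) \in lspan (eigenvectors U) ->
    phi r \in lspan (eigenvectors U).
  elim: l r => [|a l IH] r rU; first by rewrite big_nil mulmx1.
  rewrite big_cons mulmxA => h; apply: (@eigenspan_of_defect a) => //.
  have dE : eigen_defect a (phi r) = phi (r *m (A - a%:M)).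
    have -> : r *m (A - a%:M) = (- a) *: r + r *m A.
      by rewrite mulmxBr mul_mx_scalar addrC scaleNr.
    by rewrite phiP /eigen_defect Tphi scaleNr addrC.
  by rewrite dE; apply: IH => //; rewrite -dE eigen_defect_in.
move=> u uU; have [r uE] := Fs _ (UF _ uU); rewrite -/(phi r) in uE; rewrite uE in uU *.
have [l lE] := closed_field_poly_normal (char_poly A).
apply: (key l r uU).
suff -> : \prod_(a <- l) (A - a%:M) = 0.
  by rewrite mulmx0 /phi big1 ?rpred0// => i _; rewrite mxE scale0r.
have := Cayley_Hamilton A; rewrite lE (monicP (char_poly_monic A)) scale1r rmorph_prod.
by under eq_bigr do rewrite rmorphB /= horner_mx_X horner_mx_C.
Qed.

End Spectral.
End SelfAdjoint.

(** * Lowest weight vectors in a unitary module *)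

Lemma tens0l (K : nzRingType) (U W : lmodType K) (w : W) : tens (0 : U) w = 0.
Proof. by have := tensPl (-1) (0 : U) 0 w; rewrite scaler0 addr0 scaleN1r addNr. Qed.

Lemma tens0r (K : nzRingType) (U W : lmodType K) (u : U) : tens u (0 : W) = 0.
Proof. by have := tensPr (-1) u (0 : W) 0; rewrite scaler0 addr0 scaleN1r addNr. Qed.

Lemma tensZl (K : nzRingType) (U W : lmodType K) a (u : U) (w : W) :
  tens (a *: u) w = a *: tens u w.
Proof. by have := tensPl a u 0 w; rewrite tens0l !addr0. Qed.

Lemma tensZr (K : nzRingType) (U W : lmodType K) a (u : U) (w : W) :
  tens u (a *: w) = a *: tens u w.
Proof. by have := tensPr a u w 0; rewrite tens0r !addr0. Qed.

Lemma tens_sumr (K : nzRingType) (U W : lmodType K) (u : U) (J : finType) (w : J -> W) :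
  tens u (\sum_j w j) = \sum_j tens u (w j).
Proof.
elim/big_rec2: _ => [|j x y _ <-]; first exact: tens0r.
by have := tensPr 1 u (w j) y; rewrite !scale1r.
Qed.

Section LowestWeightVector.
Context {K : numFieldType} (mu nu : K).
Local Notation L := (L_u11 mu nu).

Definition L_lowest : L := projT1 (cid (L_u11P mu nu).2).
Local Notation v0 := L_lowest.
Lemma L_lowestP : u11_lowest_weight mu nu v0.
Proof. exact: projT2 (cid (L_u11P mu nu).2). Qed.

Definition L_coord (v : L) : {poly K} :=
  projT1 (cid (u11_irr_generated (L_u11P mu nu).1 L_lowestP v)).
Lemma L_coordK v : u11_ev v0 (L_coord v) = v.
Proof. by rewrite -(projT2 (cid (u11_irr_generated (L_u11P mu nu).1 L_lowestP v))). Qed.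

Lemma L_nullE i : (iter i (u11_Ep L) v0 == 0) = lw_null mu i.
Proof. exact: u11_irr_nullE (L_u11P mu nu).1 L_lowestP i. Qed.

Lemma L_Em0 : u11_Em L v0 = 0. Proof. by have [] := L_lowestP. Qed.
Lemma L_H0 : u11_H L v0 = mu *: v0. Proof. by have [] := L_lowestP. Qed.
Lemma L_Z v : u11_Z L v = nu *: v.
Proof. by rewrite -(L_coordK v) (@u11_ev_Z _ _ nu)//; have [] := L_lowestP. Qed.

(** Since v_0 generates under E_+, every vector of L is a combination of
    the E_+^j v_0, and the coefficients can be moved to the left factor. *)
Lemma tensor_tower (U : lmodType K) (z : tensor U L) :
  exists m (p : nat -> U), (forall j, (m <= j)%N -> p j = 0) /\
    z = \sum_(j < m) tens (p j) (iter j (u11_Ep L) v0).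
Proof.
have widen m (p : nat -> U) m' : (m <= m')%N -> (forall j, (m <= j)%N -> p j = 0) ->
    \sum_(j < m) tens (p j) (iter j (u11_Ep L) v0)
    = \sum_(j < m') tens (p j) (iter j (u11_Ep L) v0).
  move=> mm p0; rewrite
    (big_ord_widen m' (fun j => tens (p j) (iter j (u11_Ep L) v0)) mm).
  rewrite [RHS](bigID (fun i : 'I_m' => (i < m)%N)) /= [X in _ = _ + X]big1 ?addr0//.
  by move=> i; rewrite -leqNgt => /p0 ->; rewrite tens0l.
elim/tensor_ind: z => [|a z z' [m [p [p0 ->]]] [m' [p' [p'0 ->]]]|u w].
- by exists 0%N, (fun=> 0); rewrite big_ord0.
- exists (maxn m m'), (fun j => a *: p j + p' j); split.
    by move=> j; rewrite geq_max => /andP[/p0 -> /p'0 ->]; rewrite scaler0 addr0.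
  rewrite (widen _ _ _ (leq_maxl m m') p0) (widen _ _ _ (leq_maxr m m') p'0).
  by rewrite scaler_sumr -big_split; apply: eq_bigr => j _; rewrite tensPl.
- exists (size (L_coord w)), (fun j => (L_coord w)`_j *: u); split.
    by move=> j h; rewrite nth_default// scale0r.
  rewrite -{1}(L_coordK w) tens_sumr; apply: eq_bigr => j _.
  by rewrite tensZl tensZr.
Qed.

End LowestWeightVector.
Arguments L_lowest {K} mu nu.

Section UnitaryU11.
Context {K : numClosedFieldType} (M : u11_module K).
Local Notation Ep := (u11_Ep M).
Local Notation Em := (u11_Em M).
Local Notation H := (u11_H M).
Local Notation Z := (u11_Z M).
Variable beta : {hermitian_sym M for Num.conj}.
Hypothesis beta_pos : forall v : M, v != 0 -> 0 < beta v v.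
Hypothesis Ep_adj : forall u v, beta (Ep u) v = - beta u (Em v).

Lemma Ep_iter_adj i u v : beta (iter i Ep u) v = (-1) ^+ i * beta u (iter i Em v).
Proof.
elim: i u v => [|i IH] u v; first by rewrite mul1r.
by rewrite iterS Ep_adj IH -mulNr -iterSr exprS mulN1r.
Qed.

Section Towers.
Variables (mu : K) (p : M).
Hypotheses (Ep0 : Em p = 0) (Hp : H p = mu *: p).

(** <E_+^i p, E_+^i p> is up to sign <p, E_-^i E_+^i p>, a multiple of
    the scalar [u11_norm]. *)
Lemma unitary_null i : lw_null mu i -> iter i Ep p = 0.
Proof.
rewrite -u11_norm_eq0 => /eqP ni; apply: (beta_eq0 beta_pos).
by rewrite Ep_iter_adj (u11_Em_iter_iter Ep0 Hp) ni scale0r linear0r mulr0.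
Qed.

(** Moving E_+^i across the form applies E_-^i, with i > j, to E_+^j p,
    and E_-^(j+1) already annihilates that vector. *)
Lemma tower_orth i j p' : Em p' = 0 -> (j < i)%N -> beta (iter i Ep p') (iter j Ep p) = 0.
Proof.
move=> Ep'0 ji; rewrite Ep_iter_adj -(subnK ji) iterD iterS.
rewrite (u11_Em_iter_iter Ep0 Hp) linearZ /= Ep0 scaler0 iter_linear0.
by rewrite linear0r mulr0.
Qed.

Lemma tower_eq0 i : iter i Ep p = 0 -> lw_null mu i \/ p = 0.
Proof.
move=> h; have := u11_Em_iter_iter Ep0 Hp i; rewrite h iter_linear0 => /esym/eqP.
by rewrite scaler_eq0 u11_norm_eq0 => /orP[|/eqP]; [left|right].
Qed.

(** The intertwiner sending the lowest weight vector to p. It is defined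
    through a choice of coordinates of v; [L_mapE] shows that the choice is
    immaterial. *)
Definition L_map nu (v : L_u11 mu nu) : M := u11_ev p (L_coord v).

(** Two polynomials representing the same vector differ only in degrees i
    with E_+^i v_0 = 0, and there E_+^i p = 0 by [unitary_null]. *)
Lemma L_mapE nu q : L_map (u11_ev (L_lowest mu nu) q) = u11_ev p q.
Proof.
apply/eqP; rewrite -subr_eq0 /L_map -linearB; apply/eqP.
set r := _ - q; have r0 : u11_ev (L_lowest mu nu) r = 0.
  by rewrite linearB /= L_coordK subrr.
apply: big1 => i _; have := u11_ev_eq0 (L_H0 mu nu) r0 i.
move=> /eqP; rewrite scaler_eq0 L_nullE => /orP[/eqP ->|/unitary_null ->].
  by rewrite scale0r.
by rewrite scaler0.
Qed.

Lemma L_map_linear nu : linear (@L_map nu).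
Proof.
by move=> a v w; rewrite -{1}(L_coordK v) -{1}(L_coordK w) -linearP L_mapE linearP.
Qed.

Lemma L_map_Ep nu v : L_map (u11_Ep (L_u11 mu nu) v) = Ep (L_map v).
Proof. by rewrite -{1}(L_coordK v) u11_ev_Ep L_mapE u11_ev_Ep. Qed.

Lemma L_map_Em nu v : L_map (u11_Em (L_u11 mu nu) v) = Em (L_map v).
Proof.
rewrite -{1}(L_coordK v) (u11_ev_Em (L_Em0 mu nu) (L_H0 mu nu)) L_mapE.
by rewrite (u11_ev_Em Ep0 Hp).
Qed.

Lemma L_map_H nu v : L_map (u11_H (L_u11 mu nu) v) = H (L_map v).
Proof.
by rewrite -{1}(L_coordK v) (u11_ev_H (L_H0 mu nu)) L_mapE (u11_ev_H Hp).
Qed.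

Lemma L_map_Z nu v : Z p = nu *: p -> L_map (u11_Z (L_u11 mu nu) v) = Z (L_map v).
Proof.
move=> Zp; rewrite L_Z -{1}(L_coordK v) -linearZ L_mapE linearZ /=.
by rewrite (u11_ev_Z _ Zp).
Qed.

End Towers.
End UnitaryU11.

(** * Decomposition of a graded unitary module *)

Section Isotypic.
Context {K : numFieldType} {V : lmodType K}.
Variables (mu : nat -> K) (P : nat -> K -> submodClosed V) (sp : nat -> {pred K}).

Definition isotypic k (l : {l | l \in sp k}) : lmodType K :=
  tensor (subspace (P k (val l))) (L_u11 (mu k) (val l)).

Definition isotypic_sum : lmodType K := dsum (fun k => dsum (@isotypic k)).

Definition joint_tens k (l : {l | l \in sp k}) (p : subspace (P k (val l)))
    (v : L_u11 (mu k) (val l)) : isotypic_sum :=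
  din (fun k => dsum (@isotypic k)) k (din (@isotypic k) l (tens p v)).

End Isotypic.

(** M is graded by finitely spanned subspaces deg k, on which H acts by
    distinct scalars mu k; P k l stands for the harmonic vectors of degree k and
    Z-eigenvalue l, and sp k contains the eigenvalues that occur. *)
Section JointDecomposition.
Context {K : numClosedFieldType} (M : u11_module K).
Local Notation Ep := (u11_Ep M).
Local Notation Em := (u11_Em M).
Local Notation H := (u11_H M).
Local Notation Z := (u11_Z M).
Variable beta : {hermitian_sym M for Num.conj}.
Hypothesis beta_pos : forall v : M, v != 0 -> 0 < beta v v.
Hypothesis Ep_adj : forall u v, beta (Ep u) v = - beta u (Em v).
Hypothesis Em_adj : forall u v, beta (Em u) v = - beta u (Ep v).
Hypothesis H_adj : forall u v, beta (H u) v = beta u (H v).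
Hypothesis Z_adj : forall u v, beta (Z u) v = beta u (Z v).

Variables (deg : nat -> submodClosed M) (mu : nat -> K).
Hypothesis mu_inj : injective mu.
Hypothesis deg_H : forall k u, u \in deg k -> H u = mu k *: u.
Hypothesis deg_span : forall u, u \in lspan [set v | exists k, v \in deg k].
Hypothesis deg_fin : forall k, finitely_spanned (deg k).
Hypothesis deg_Ep : forall k u, u \in deg k -> Ep u \in deg k.+2.
Hypothesis deg_Em : forall k u, u \in deg k.+2 -> Em u \in deg k.
Hypothesis deg_Em0 : forall k u, (k < 2)%N -> u \in deg k -> Em u = 0.
Hypothesis deg_Z : forall k u, u \in deg k -> Z u \in deg k.

Variables (P : nat -> K -> submodClosed M) (sp : nat -> {pred K}).
Hypothesis PP : forall k l p,
  reflect [/\ p \in deg k, Em p = 0 & Z p = l *: p] (p \in P k l).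
Hypothesis spP : forall k l p, p \in P k l -> p != 0 -> l \in sp k.

Lemma deg_sum u : exists m (w : nat -> M),
  (forall i, w i \in deg i) /\ u = \sum_(i < m) w i.
Proof.
have := deg_span u; move: u; apply: lspan_ind.
- by exists 0%N, (fun=> 0); split=> [i|]; rewrite ?rpred0 ?big_ord0.
- move=> a u v [m [w [wd ->]]] [m' [w' [wd' ->]]].
  exists (maxn m m'), (fun i => a *: (if (i < m)%N then w i else 0)
    + (if (i < m')%N then w' i else 0)); split.
    by move=> i; rewrite rpredD ?rpredZ//; case: ifP; rewrite ?rpred0.
  rewrite big_split -scaler_sumr; congr (a *: _ + _).
    by rewrite (big_ord_widen _ _ (leq_maxl m m')) big_mkcond.
  by rewrite (big_ord_widen _ _ (leq_maxr m m')) big_mkcond.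
- move=> u [k uk]; exists k.+1, (fun i => if i == k then u else 0); split.
    by move=> i; case: eqP => [->//|_]; exact: rpred0.
  rewrite (bigD1 ord_max)//= eqxx big1 ?addr0// => i ik.
  by case: eqP => // ik'; case/eqP: ik; exact: val_inj.
Qed.

(** The homogeneous components of u in degrees other than k are
    eigenvectors with other eigenvalues, hence vanish. *)
Lemma deg_of_weight k u : H u = mu k *: u -> u \in deg k.
Proof.
have [m [w [wd ->]]] := deg_sum u => Hu.
have w0 (i : 'I_m) : (mu i - mu k) *: w i = 0.
  apply: (@eigen_indep _ _ H _ (index_enum 'I_m)
    (fun i : 'I_m => (mu i - mu k) *: w i) (fun i : 'I_m => mu i)).
  - exact: index_enum_uniq.
  - by move=> i1 i2 _ _ /mu_inj/val_inj.
  - by move=> j _; rewrite linearZ /= (deg_H (wd j)) !scalerA mulrC.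
  - under eq_bigr do rewrite scalerBl.
    rewrite sumrB -scaler_sumr -Hu linear_sum; apply/eqP; rewrite subr_eq0; apply/eqP.
    by apply: eq_bigr => j _; rewrite (deg_H (wd j)).
  - exact: mem_index_enum.
apply: rpred_sum => i _; have [<-//|ik] := eqVneq (val i) k.
move/eqP: (w0 i); rewrite scaler_eq0 subr_eq0 => /orP[/eqP/mu_inj h|/eqP ->].
  by rewrite /= h eqxx in ik.
exact: rpred0.
Qed.

Lemma P_preserved (T : {linear M -> M}) :
  (forall u, T (Em u) = Em (T u)) -> (forall u, T (H u) = H (T u)) ->
  (forall u, T (Z u) = Z (T u)) -> forall k l p, p \in P k l -> T p \in P k l.
Proof.
move=> TE TH TZ k l p /PP[pk p0 pl]; apply/PP; split.
- by apply: deg_of_weight; rewrite -TH (deg_H pk) linearZ.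
- by rewrite -TE p0 linear0.
- by rewrite -TZ pl linearZ.
Qed.

Local Notation iso k := (@isotypic K M mu P sp k).
Local Notation jtens k l := (@joint_tens K M mu P sp k l).
Local Notation layer k := (dsum (iso k)).
Local Notation total := (isotypic_sum mu P sp).
Local Notation string k l i :=
  (iter i (u11_Ep (L_u11 (mu k) (val l))) (L_lowest (mu k) (val l))).

Lemma P_Em k l (p : subspace (P k l)) : Em (val p) = 0.
Proof. by have /PP[] := valP p. Qed.
Lemma P_H k l (p : subspace (P k l)) : H (val p) = mu k *: val p.
Proof. by have /PP[/deg_H] := valP p. Qed.
Lemma P_Z k l (p : subspace (P k l)) : Z (val p) = l *: val p.
Proof. by have /PP[] := valP p. Qed.

Definition isotypic_act k l (p : subspace (P k l)) (v : L_u11 (mu k) l) : M :=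
  L_map (val p) v.

Lemma isotypic_act_l k l v : linear ((@isotypic_act k l)^~ v).
Proof. by move=> a p q; exact: u11_ev_linearl. Qed.
Lemma isotypic_act_r k l p : linear (@isotypic_act k l p).
Proof. exact: L_map_linear beta_pos Ep_adj _ _ (P_Em p) (P_H p) _. Qed.

Definition isotypic_map k (l : {l | l \in sp k}) : iso k l -> M :=
  tlift (@isotypic_act k (val l)).
HB.instance Definition _ k (l : {l | l \in sp k}) :=
  GRing.isLinear.Build K (iso k l) M _ (isotypic_map (l := l))
    (tlift_linear (@isotypic_act_l k (val l)) (@isotypic_act_r k (val l))).

Lemma isotypic_mapE k (l : {l | l \in sp k}) p v :
  isotypic_map (l := l) (tens p v) = isotypic_act p v.
Proof. exact: tliftE (@isotypic_act_l k (val l)) (@isotypic_act_r k (val l)) p v. Qed.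

Lemma isotypic_map_lowest k (l : {l | l \in sp k}) (p : subspace (P k (val l))) i :
  isotypic_map (l := l) (tens p (string k l i)) = iter i Ep (val p).
Proof.
rewrite isotypic_mapE -(u11_evXn (L_lowest (mu k) (val l))).
by rewrite /isotypic_act (L_mapE beta_pos Ep_adj (P_Em p) (P_H p)) u11_evXn.
Qed.

Lemma isotypic_map_tower k (l : {l | l \in sp k}) (z : iso k l) :
  exists m (p : nat -> subspace (P k (val l))),
    z = \sum_(j < m) tens (p j) (string k l j) /\
    isotypic_map z = \sum_(j < m) iter j Ep (val (p j)).
Proof.
have [m [p [_ zE]]] := tensor_tower z; exists m, p; split=> //.
rewrite zE linear_sum; apply: eq_bigr => j _; exact: isotypic_map_lowest.
Qed.

Lemma tower_orth_neq k l k' l' (p : subspace (P k l)) (p' : subspace (P k' l')) i j :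
  i != j -> beta (iter i Ep (val p)) (iter j Ep (val p')) = 0.
Proof.
case: ltngtP => // ij _; first apply: (beta_sym0 (beta := beta)).
  exact: tower_orth Ep_adj _ _ (P_Em p) (P_H p) _ _ _ (P_Em p') ij.
exact: tower_orth Ep_adj _ _ (P_Em p') (P_H p') _ _ _ (P_Em p) ij.
Qed.

(** For equal heights i the vectors differ in their H- or Z-eigenvalue;
    for different heights [tower_orth] applies. *)
Lemma isotypic_orth k l k' l' (p : subspace (P k l)) (p' : subspace (P k' l')) i j :
  (k != k') || (l != l') -> beta (iter i Ep (val p)) (iter j Ep (val p')) = 0.
Proof.
have [<-|ij _] := eqVneq i j; last exact: tower_orth_neq.
case/orP => h.
  apply: (selfadj_orth beta_pos H_adj (u11_H_iter (P_H p) i) (u11_H_iter (P_H p') i)).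
  by rewrite (inj_eq (addIr _)) (inj_eq mu_inj).
exact: (selfadj_orth beta_pos Z_adj (u11_Z_iter _ (P_Z p)) (u11_Z_iter _ (P_Z p'))).
Qed.

(** The terms of the image are orthogonal, so each of them vanishes; then
    p_j = 0, or the corresponding vector of L vanishes too. *)
Lemma isotypic_map_inj k (l : {l | l \in sp k}) (z : iso k l) :
  isotypic_map z = 0 -> z = 0.
Proof.
have [m [p [-> ->]]] := isotypic_map_tower z => s0.
apply: big1 => j _; have pj : iter j Ep (val (p j)) = 0.
  apply: (orth_indep beta_pos (index_enum_uniq 'I_m) _ s0 (mem_index_enum j)).
  by move=> i1 i2 _ _ i12; apply: tower_orth_neq.
have [|p0] := tower_eq0 (P_Em (p j)) (P_H (p j)) pj.
  by rewrite -(L_nullE (mu k) (val l)) => /eqP ->; rewrite tens0r.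
by rewrite (_ : p j = 0) ?tens0l//; apply: val_inj.
Qed.

Lemma isotypic_map_orth k k' (l : {l | l \in sp k}) (l' : {l | l \in sp k'})
    (z : iso k l) (z' : iso k' l') :
  (k != k') || (val l != val l') -> beta (isotypic_map z) (isotypic_map z') = 0.
Proof.
have [m [p [_ ->]]] := isotypic_map_tower z.
have [m' [p' [_ ->]]] := isotypic_map_tower z' => h.
rewrite linear_sumlz big1// => i _; rewrite linear_sumr big1// => j _.
exact: isotypic_orth.
Qed.

Definition layer_map k : layer k -> M :=
  dlift (iso k) (fun l => isotypic_map (l := l)).
HB.instance Definition _ k := GRing.Linear.on (layer_map (k := k)).

Lemma layer_map_inj k (z : layer k) : layer_map z = 0 -> z = 0.
Proof.
apply: dlift_inj => [l u|s u us]; first exact: isotypic_map_inj.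
apply: (orth_indep beta_pos us) => l l' _ _ ll'.
by apply: isotypic_map_orth; rewrite (inj_eq val_inj) ll' orbT.
Qed.

Lemma layer_map_orth k k' (z : layer k) (z' : layer k') : k != k' ->
  beta (layer_map z) (layer_map z') = 0.
Proof.
move=> kk'; move: z; apply: dsum_ind.
- by rewrite linear0 linear0l.
- by move=> a u v zu zv; rewrite linearP linearPl /= zu zv mulr0 addr0.
move=> l u; move: z'; apply: dsum_ind.
- by rewrite linear0 linear0r.
- by move=> a v w zv zw; rewrite linearP linearPr /= zv zw mulr0 addr0.
by move=> l' v; rewrite /layer_map !dliftE; apply: isotypic_map_orth; rewrite kk'.
Qed.

Definition joint_map : total -> M :=
  dlift (fun k => layer k) (fun k => layer_map (k := k)).
HB.instance Definition _ := GRing.Linear.on joint_map.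

Lemma joint_map_inj (z : total) : joint_map z = 0 -> z = 0.
Proof.
apply: dlift_inj => [k u|s u us]; first exact: layer_map_inj.
by apply: (orth_indep beta_pos us) => k k' _ _; exact: layer_map_orth.
Qed.

Lemma joint_mapE k (l : {l | l \in sp k}) p v :
  joint_map (jtens k l p v) = isotypic_act p v.
Proof.
rewrite /joint_map /joint_tens dliftE; apply: etrans (dliftE _ _) _.
exact: isotypic_mapE.
Qed.

Lemma total_ind (Q : total -> Prop) :
  Q 0 -> (forall a u v, Q u -> Q v -> Q (a *: u + v)) ->
  (forall k (l : {l | l \in sp k}) p v, Q (jtens k l p v)) -> forall z, Q z.
Proof.
move=> Q0 QD QT; apply: (dsum_ind Q0 QD) => k.
pose outer := din (fun k => layer k) k.
have outer0 : outer 0 = 0 := linear0 outer.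
have outerP a u v : outer (a *: u + v) = a *: outer u + outer v :=
  @din_linear K nat (fun k => layer k) k a u v.
apply: (@dsum_ind _ _ (iso k) (fun u => Q (outer u))).
- exact (eq_ind_r Q Q0 outer0).
- by move=> a u v Qu Qv; exact (eq_ind_r Q (QD a _ _ Qu Qv) (outerP a u v)).
move=> l; pose inner := din (iso k) l.
have inner0 : inner 0 = 0 := linear0 inner.
have innerP a u v : inner (a *: u + v) = a *: inner u + inner v :=
  @din_linear K _ (iso k) l a u v.
apply: (@tensor_ind _ _ _ (fun u => Q (outer (inner u)))).
- exact (eq_ind_r Q Q0 (etrans (congr1 outer inner0) outer0)).
- move=> a u v Qu Qv.
  exact (eq_ind_r Q (QD a _ _ Qu Qv)
    (etrans (congr1 outer (innerP a u v)) (outerP a _ _))).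
- exact: QT.
Qed.

Definition joint_image : {pred M} := fun u => `[< exists z, joint_map z = u >].
Lemma joint_image_closed : submod_closed joint_image.
Proof.
split; first by apply/asboolP; exists 0; rewrite linear0.
move=> a u v /asboolP[z <-] /asboolP[z' <-]; apply/asboolP.
by exists (a *: z + z'); rewrite linearP.
Qed.
HB.instance Definition _ :=
  GRing.isSubmodClosed.Build K M joint_image joint_image_closed.

Lemma joint_image_Ep u : u \in joint_image -> Ep u \in joint_image.
Proof.
move=> /asboolP[z <-]; move: z; apply: total_ind.
- by rewrite !linear0 rpred0.
- by move=> a u' v Qu Qv; rewrite !linearP rpredD ?rpredZ.
move=> k l p v; apply/asboolP; exists (jtens k l p (u11_Ep _ v)).
apply: etrans (joint_mapE p _) _.
apply: etrans (L_map_Ep beta_pos Ep_adj (P_Em p) (P_H p) v) _.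
exact (congr1 Ep (esym (joint_mapE p v))).
Qed.

Lemma joint_image_P k l p : p \in P k l -> p \in joint_image.
Proof.
move=> pP; have [->|p0] := eqVneq p 0; first exact: rpred0.
pose l' : {l | l \in sp k} := exist _ l (spP pP p0).
apply/asboolP; exists (jtens k l' (Subspace pP) (L_lowest (mu k) l)).
rewrite joint_mapE -isotypic_mapE.
exact: (@isotypic_map_lowest k l' (Subspace pP) 0).
Qed.

Definition harmonics k : {pred M} := fun u => (u \in deg k) && (Em u == 0).
Lemma harmonicsP k u : reflect (u \in deg k /\ Em u = 0) (u \in harmonics k).
Proof. by apply: (iffP andP) => -[? /eqP]. Qed.
Lemma harmonics_closed k : submod_closed (harmonics k).
Proof.
split; first by apply/harmonicsP; rewrite rpred0 linear0.
move=> a u v /harmonicsP[uk u0] /harmonicsP[vk v0]; apply/harmonicsP.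
by rewrite rpredD ?rpredZ// linearP u0 v0 scaler0 addr0.
Qed.
HB.instance Definition _ k :=
  GRing.isSubmodClosed.Build K M (harmonics k) (harmonics_closed k).

Lemma joint_image_harmonics k u : u \in harmonics k -> u \in joint_image.
Proof.
move=> uh; apply: (lspan_sub (U := joint_image)) (selfadj_eigenspan
  (U := harmonics k) beta_pos Z_adj _ (deg_fin k) (@deg_Z k) _ uh).
- by move=> v [/harmonicsP[vk v0] [l vl]]; apply: (@joint_image_P k l); apply/PP.
- move=> v /harmonicsP[vk v0]; apply/harmonicsP; split; first exact: deg_Z.
  by rewrite -u11_ZEm v0 linear0.
- by move=> v /harmonicsP[].
Qed.

Lemma EpEm_adj u v : beta (Ep (Em u)) v = beta u (Ep (Em v)).
Proof. by rewrite Ep_adj Em_adj opprK. Qed.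

Lemma EpEm_deg k u : u \in deg k -> Ep (Em u) \in deg k.
Proof.
case: k => [|[|k]] uk; try by rewrite (deg_Em0 _ uk)// linear0 rpred0.
by apply: deg_Ep; exact: deg_Em.
Qed.

(** E_+ E_- is self-adjoint on deg k. Its kernel is ker E_-, and its other
    eigenvectors lie in the image under E_+ of degree k - 2, which is treated
    by induction. *)
Lemma joint_image_deg k u : u \in deg k -> u \in joint_image.
Proof.
elim/ltn_ind: k u => k IH u uk.
apply: (lspan_sub (U := joint_image)) (selfadj_eigenspan
  (U := deg k) (T := Ep \o Em) beta_pos EpEm_adj (@EpEm_deg k) (deg_fin k)
  (@EpEm_deg k) _ uk) => // v [vk [a /= va]].
have [v0|v0] := eqVneq (Em v) 0.
  by apply: (@joint_image_harmonics k); apply/harmonicsP.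
(* <E_- v, E_- v> = - <v, E_+ E_- v> would vanish *)
have a0 : a != 0.
  apply: contra_neq v0 => a0; apply: (beta_eq0 beta_pos).
  by rewrite Em_adj va a0 scale0r linear0r oppr0.
rewrite -[v]scale1r -(mulVf a0) -scalerA -va rpredZ// joint_image_Ep//.
case: k IH vk {uk} => [|[|k]] IH vk; try by rewrite (deg_Em0 _ vk) ?eqxx in v0.
by apply: (IH k) => //; exact: deg_Em.
Qed.

Lemma joint_map_surj u : exists z, joint_map z = u.
Proof.
apply/asboolP; apply: (lspan_sub (U := joint_image)) (deg_span u) => v [k].
exact: joint_image_deg.
Qed.

Lemma joint_map_bij : bijective joint_map.
Proof.
have [g gK] := choice joint_map_surj; exists g => // z.
apply/eqP; rewrite -subr_eq0; apply/eqP/joint_map_inj.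
by rewrite linearB /= gK subrr.
Qed.

Lemma joint_map_intertwine k (l : {l | l \in sp k}) p v v' (S : M -> M) :
  L_map (val p) v' = S (L_map (val p) v) ->
  joint_map (jtens k l p v') = S (joint_map (jtens k l p v)).
Proof.
move=> h; apply: etrans (joint_mapE p v') _.
exact (etrans h (congr1 S (esym (joint_mapE p v)))).
Qed.

Theorem joint_decomposition :
  exists Phi : {linear total -> M},
    [/\ bijective Phi,
        forall k (l : {l | l \in sp k}) (T : {linear M -> M}) p q v,
          (forall u, T (Ep u) = Ep (T u)) -> val q = T (val p) ->
          Phi (jtens k l q v) = T (Phi (jtens k l p v))
      & forall k (l : {l | l \in sp k}) p v,
          let L := L_u11 (mu k) (val l) in
          [/\ Phi (jtens k l p (u11_Ep L v)) = Ep (Phi (jtens k l p v)),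
              Phi (jtens k l p (u11_Em L v)) = Em (Phi (jtens k l p v)),
              Phi (jtens k l p (u11_H L v)) = H (Phi (jtens k l p v))
            & Phi (jtens k l p (u11_Z L v)) = Z (Phi (jtens k l p v))]].
Proof.
exists joint_map; split=> [|k l T p q v TE qE|k l p v L].
- exact: joint_map_bij.
- apply: etrans (joint_mapE q v) _.
  apply: etrans _ (congr1 T (esym (joint_mapE p v))).
  rewrite /isotypic_act /L_map qE linear_sum; apply: eq_bigr => i _.
  by rewrite linearZ; congr (_ *: _); elim: (val i) => //= j ->.
- split; apply: joint_map_intertwine.
  + exact: L_map_Ep beta_pos Ep_adj _ _ (P_Em p) (P_H p) _ _.
  + exact: L_map_Em beta_pos Ep_adj _ _ (P_Em p) (P_H p) _ _.
  + exact: L_map_H beta_pos Ep_adj _ _ (P_Em p) (P_H p) _ _.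
  + exact: L_map_Z beta_pos Ep_adj _ _ (P_Em p) (P_H p) _ _ (P_Z p).
Qed.

End JointDecomposition.

(** * Grading of a module generated in degree zero *)

Section FiniteSpan.
Context {K : nzRingType} {V : lmodType K}.

(** The zero vector is prepended since a spanning family is indexed by
    a nonempty ordinal. *)
Lemma finitely_spanned_seq (F : submodClosed V) (s : seq V) :
  {subset s <= F} -> (forall u, u \in F -> u \in lspan [set v | v \in s]) ->
  finitely_spanned F.
Proof.
move=> sF Fs; exists (size s), (fun i : 'I_(size s).+1 => nth 0 ((0 : V) :: s) i); split.
  move=> i; have := mem_nth (0 : V) (ltn_ord i : (i < size ((0%R : V) :: s))%N).
  by rewrite inE => /orP[/eqP ->|/sF//]; exact: rpred0.
move=> u /Fs; move: u; apply: lspan_ind.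
- by exists 0; rewrite big1// => i _; rewrite mxE scale0r.
- move=> a u v [r ->] [r' ->]; exists (a *: r + r').
  rewrite scaler_sumr -big_split; apply: eq_bigr => i _.
  by rewrite !mxE scalerDl scalerA.
- move=> u us; have iu : (index u ((0%R : V) :: s) < (size s).+1)%N.
    by rewrite -[(size s).+1]/(size ((0 : V) :: s)) index_mem inE us orbT.
  exists (delta_mx 0 (Ordinal iu)); rewrite (bigD1 (Ordinal iu))//= mxE !eqxx scale1r.
  rewrite [X in X + _](nth_index 0 (_ : u \in 0 :: s)); last by rewrite inE us orbT.
  by rewrite big1 ?addr0// => i iN; rewrite mxE (negPf iN) andbF scale0r.
Qed.

End FiniteSpan.

(** The operators X raise the degree from the generating space inn T in
    degree zero, which V kills; the commutators of V with X are combinations of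
    the identity and the degree-preserving G. *)
Section GradedModule.
Context {K : comNzRingType} {M : lmodType K} {ET VT GT : Type} {T : lmodType K}.
Variables (X : ET -> {linear M -> M}) (V : VT -> {linear M -> M}).
Variables (G : GT -> {linear M -> M}) (inn : {linear T -> M}).
Variable (deg : nat -> submodClosed M).
Hypothesis deg_in : forall v, inn v \in deg 0.
Hypothesis deg_X : forall k x u, u \in deg k -> X x u \in deg k.+1.
Hypothesis deg_ind0 : forall Q : M -> Prop,
  Q 0 -> (forall a u v, Q u -> Q v -> Q (a *: u + v)) -> (forall v, Q (inn v)) ->
  forall u, u \in deg 0 -> Q u.
Hypothesis deg_indS : forall k (Q : M -> Prop),
  Q 0 -> (forall a u v, Q u -> Q v -> Q (a *: u + v)) ->
  (forall x u, u \in deg k -> Q (X x u)) -> forall u, u \in deg k.+1 -> Q u.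

Variables (actG : GT -> T -> T) (actX : GT -> ET -> ET).
Hypothesis G_in : forall g v, G g (inn v) = inn (actG g v).
Hypothesis GX : forall g x u, G g (X x u) = X (actX g x) (G g u).

Lemma deg_linear_ind0 (f : {linear M -> M}) k' :
  (forall v, f (inn v) \in deg k') -> forall u, u \in deg 0 -> f u \in deg k'.
Proof.
move=> fin; apply: deg_ind0 => //; first by rewrite linear0 rpred0.
by move=> a u v fu fv; rewrite linearP rpredD ?rpredZ.
Qed.

Lemma deg_linear_indS (f : {linear M -> M}) k k' :
  (forall x u, u \in deg k -> f (X x u) \in deg k') ->
  forall u, u \in deg k.+1 -> f u \in deg k'.
Proof.
move=> fX; apply: deg_indS => //; first by rewrite linear0 rpred0.
by move=> a u v fu fv; rewrite linearP rpredD ?rpredZ.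
Qed.

Lemma deg_G g k u : u \in deg k -> G g u \in deg k.
Proof.
elim: k u => [|k IH]; first by apply: deg_linear_ind0 => v; rewrite G_in.
by apply: deg_linear_indS => x u uk; rewrite GX deg_X ?IH.
Qed.

Variables (S : finType) (refl : pred S) (toG : S -> GT).
Variables (a : VT -> ET -> K) (b : VT -> ET -> S -> K).
Hypothesis V_in : forall xi v, V xi (inn v) = 0.
Hypothesis VX : forall xi x u, V xi (X x u) = X x (V xi u)
  + (a xi x *: u - \sum_(s | refl s) b xi x s *: G (toG s) u).

Lemma deg_V0 xi u : u \in deg 0 -> V xi u = 0.
Proof.
move: u; apply: deg_ind0 => //; first exact: linear0.
by move=> c u v Vu Vv; rewrite linearP Vu Vv scaler0 addr0.
Qed.

(** Moving V past the leftmost X of X u leaves X (V u), covered by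
    induction, and terms in the degree of u, one less than that of X u. *)
Lemma deg_V xi k u : u \in deg k.+1 -> V xi u \in deg k.
Proof.
have tail x m v : v \in deg m ->
    a xi x *: v - \sum_(s | refl s) b xi x s *: G (toG s) v \in deg m.
  move=> vm; rewrite submodB ?rpredZ// rpred_sum// => s _.
  by rewrite rpredZ// deg_G.
elim: k u => [|k IH]; apply: deg_linear_indS => x u uk; rewrite VX.
  by rewrite deg_V0// linear0 add0r tail.
by rewrite rpredD ?tail// deg_X// IH.
Qed.

Variables (H : {linear M -> M}) (mu : nat -> K).
Hypothesis muS : forall k, mu k.+1 = mu k + 1.
Hypothesis H_in : forall v, H (inn v) = mu 0%N *: inn v.
Hypothesis HX : forall x u, H (X x u) = X x (H u) + X x u.

Lemma deg_weight k u : u \in deg k -> H u = mu k *: u.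
Proof.
have lin k' : forall r u v, H u = mu k' *: u -> H v = mu k' *: v ->
    H (r *: u + v) = mu k' *: (r *: u + v).
  by move=> r x y Hx Hy; rewrite linearP Hx Hy scalerDr !scalerA mulrC.
elim: k u => [|k IH].
  by apply: (deg_ind0 _ (lin 0%N) H_in); rewrite linear0 scaler0.
apply: (deg_indS _ (lin k.+1)) => [|x u uk]; first by rewrite linear0 scaler0.
by rewrite HX (IH _ uk) linearZ muS scalerDl scale1r.
Qed.

Variables (J : finType) (e : J -> ET) (coef : ET -> J -> K).
Hypothesis X_decomp : forall x u, X x u = \sum_j coef x j *: X (e j) u.
Variable t : seq T.
Hypothesis t_span : forall v, v \in lspan [set w | w \in t].

Lemma deg_finitely_spanned k : finitely_spanned (deg k).
Proof.
suff [s sk ks] : exists2 s : seq M, {subset s <= deg k} &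
    forall u, u \in deg k -> u \in lspan [set v | v \in s].
  exact: finitely_spanned_seq ks.
elim: k => [|k [s sk ks]].
  exists [seq inn v | v <- t]; first by move=> _ /mapP[v _ ->].
  apply: deg_ind0; first exact: rpred0.
    by move=> c u v us vs; rewrite rpredD ?rpredZ.
  move=> v; move: v (t_span v); apply: lspan_ind; first by rewrite linear0 rpred0.
    by move=> c u v us vs; rewrite linearP rpredD ?rpredZ.
  by move=> v vt; rewrite mem_lspan//; exact: map_f.
exists [seq X (e j) v | j <- enum J, v <- s].
  by move=> _ /allpairsP[[j v] [_ vs ->]]; apply/deg_X/sk.
apply: deg_indS; first exact: rpred0.
  by move=> c u v us vs; rewrite rpredD ?rpredZ.
move=> x u /ks us; rewrite X_decomp; apply: rpred_sum => j _; rewrite rpredZ//.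
move: u us; apply: lspan_ind; first by rewrite linear0 rpred0.
  by move=> c u v us vs; rewrite linearP rpredD ?rpredZ.
move=> u us; apply: mem_lspan; apply/allpairsP; exists (j, u).
by split=> //=; rewrite mem_enum.
Qed.

Hypothesis gen : forall U : submodClosed M, (forall v, inn v \in U) ->
  (forall x u, u \in U -> X x u \in U) -> (forall xi u, u \in U -> V xi u \in U) ->
  (forall g u, u \in U -> G g u \in U) -> forall u, u \in U.

Lemma deg_generate u : u \in lspan [set v | exists k, v \in deg k].
Proof.
have stab (f : {linear M -> M}) :
    (forall k v, v \in deg k -> exists k', f v \in deg k') ->
    forall v, v \in lspan [set v | exists k, v \in deg k] ->
    f v \in lspan [set v | exists k, v \in deg k].
  move=> fdeg; apply: lspan_ind; first by rewrite linear0 rpred0.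
    by move=> c v w fv fw; rewrite linearP rpredD ?rpredZ.
  by move=> v [k /fdeg[k' fv]]; apply: mem_lspan; exists k'.
apply: gen.
- by move=> v; apply: mem_lspan; exists 0%N.
- by move=> x; apply: stab => k v vk; exists k.+1; exact: deg_X.
- move=> xi; apply: stab => -[|k] v vk; last by exists k; exact: deg_V.
  by exists 0%N; rewrite deg_V0// rpred0.
- by move=> g; apply: stab => k v vk; exists k; exact: deg_G.
Qed.

End GradedModule.

(** * The standard module *)

Lemma free_alg_ind (K : comNzRingType) (I : choiceType) (P : free_alg K I -> Prop) :
  P 0 -> (forall a p q, P p -> P q -> P (a *: p + q)) ->
  P 1 -> (forall i p, P p -> P (free_gen K i * p)) -> forall p, P p.
Proof.
move=> P0 PD P1 PM; apply: (malg_ind P0 PD) => -[s].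
elim: s => [|i s IH].
  have -> : << FMonom [::] >> = 1 :> {malg K[{fmonom I}]} by rewrite -fmoneE.
  exact: P1.
have -> : << FMonom (i :: s) >> = << fmu i >> * << FMonom s >> :> {malg K[{fmonom I}]}.
  by rewrite malgM_def fgmulUU mulr1; congr << _ >>; rewrite /mmul /= fmmulE fmuE.
exact: PM.
Qed.

Lemma qalg_free_ind (K : comNzRingType) (I : choiceType) (S : set (free_alg K I))
    (P : qalg S -> Prop) :
  P 0 -> (forall a u v, P u -> P v -> P (a *: u + v)) ->
  P 1 -> (forall i u, P u -> P ((qpi (two_sided S) (free_gen K i) : qalg S) * u)) ->
  forall u, P u.
Proof.
move=> P0 PD P1 PM u; rewrite -[u]qreprK.
apply: (@free_alg_ind K I (fun p => P (qpi (two_sided S) p))) => [|a p q Pp Pq||i p Pp].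
- by rewrite linear0.
- by rewrite linearP; exact: PD.
- exact: P1.
- by rewrite qpi_algM; exact: PM.
Qed.

Section LinearSteps.
Context {K : comNzRingType} {V W : lmodType K}.
Implicit Types (f g h : {linear V -> W}).

(** The induction step along linear combinations for identities between
    linear maps. *)
Lemma linear_step_comb f g h a b u v :
  f u = a *: g u + h u -> f v = a *: g v + h v ->
  f (b *: u + v) = a *: g (b *: u + v) + h (b *: u + v).
Proof.
move=> fu fv; rewrite !linearP fu fv !scalerDr !scalerA [b * a]mulrC.
by rewrite -!addrA; congr (_ + _); rewrite addrCA.
Qed.

Lemma linear_step_eq f g b u v :
  f u = g u -> f v = g v -> f (b *: u + v) = g (b *: u + v).
Proof. by move=> fu fv; rewrite !linearP fu fv. Qed.

Lemma linear_step_in f (U : submodClosed W) b u v :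
  f u \in U -> f v \in U -> f (b *: u + v) \in U.
Proof. by move=> fu fv; rewrite linearP rpredD ?rpredZ. Qed.

Lemma linear_comb_eq (J : finType) (P : pred J) f (c : J -> K) (y : J -> V) a u :
  \sum_(j | P j) c j *: y j = a *: u -> \sum_(j | P j) c j *: f (y j) = a *: f u.
Proof.
move/(congr1 f); rewrite linear_sum linearZ /= => <-.
by apply: eq_bigr => j _; rewrite linearZ.
Qed.

End LinearSteps.

Lemma prod_tuple_cons (A : pzRingType) (T : Type) (f : T -> A) m (x : T)
    (y : m.-tuple T) :
  \prod_(i < m.+1) f (tnth [tuple of x :: y] i) = f x * \prod_(i < m) f (tnth y i).
Proof.
rewrite big_ord_recl tnth0; congr (_ * _).
by apply: eq_bigr => i _; rewrite tnthS.
Qed.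

Section StdTheory.
Context {R : realType} {E : vectType R} {gT : finGroupType}.
Context {D : reflection_datum E gT} {tau : irrep (Cx R) gT}.
Local Notation M := (std D tau).
Local Notation X := (rca_cov D).
Local Notation V := (rca_vec D).
Local Notation G := (rca_grp D).
Implicit Types (h k : rca D) (u v : M).

Lemma rca_ind (P : rca D -> Prop) :
  P 0 -> (forall a h k, P h -> P k -> P (a *: h + k)) -> P 1 ->
  (forall x h, P h -> P (X x * h)) -> (forall xi h, P h -> P (V xi * h)) ->
  (forall g h, P h -> P (G g * h)) -> forall h, P h.
Proof.
move=> P0 PD P1 PX PV PG; apply: (qalg_free_ind P0 PD P1).
by case=> [[xi|x]|g] h Ph; [exact: PV | exact: PX | exact: PG].
Qed.

Lemma std_ind (P : M -> Prop) :
  P 0 -> (forall a u v, P u -> P v -> P (a *: u + v)) ->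
  (forall h w, P (std_tens D tau h w)) -> forall u, P u.
Proof.
move=> P0 PD PT u; rewrite -[u]qreprK.
apply: (@tensor_ind _ _ _ (fun t => P (qpi (std_rel (tau := tau)) t)))
  => [|a p q Pp Pq|h w].
- by rewrite linear0.
- by rewrite linearP; exact: PD.
- exact: PT.
Qed.

Lemma std_actP a h k u : std_act (a *: h + k) u = a *: std_act h u + std_act k u.
Proof.
move: u; apply: std_ind => [|b u v hu hv|k' w].
- by rewrite !linear0 addr0.
- exact: linear_step_comb hu hv.
- by rewrite !std_actE mulrDl -rca_scalerAl; exact: std_tensPl.
Qed.

Lemma std_actM h k u : std_act (h * k) u = std_act h (std_act k u).
Proof.
move: u; apply: std_ind => [|b u v hu hv|k' w].
- by rewrite !linear0.
- exact: (linear_step_eq (g := std_act h \o std_act k) b hu hv).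
- by rewrite !std_actE mulrA.
Qed.

Lemma std_act1 u : std_act (1 : rca D) u = u.
Proof.
move: u; apply: std_ind => [|b u v hu hv|k' w].
- by rewrite linear0.
- exact: (linear_step_eq (g := idfun) b hu hv).
- by rewrite std_actE mul1r.
Qed.

Lemma std_act0 u : std_act (0 : rca D) u = 0.
Proof.
have := std_actP (-1) 0 0 u; rewrite scaler0 addr0 scaleN1r => h.
by rewrite h addNr.
Qed.

Lemma std_actZ a h u : std_act (a *: h) u = a *: std_act h u.
Proof. by have := std_actP a h 0 u; rewrite std_act0 !addr0. Qed.

Lemma std_actD h k u : std_act (h + k) u = std_act h u + std_act k u.
Proof. by have := std_actP 1 h k u; rewrite !scale1r. Qed.

Lemma std_actN h u : std_act (- h) u = - std_act h u.
Proof. by have := std_actZ (-1) h u; rewrite (scaleN1r h) (scaleN1r (std_act h u)). Qed.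

Lemma std_act_sum (J : finType) (P : pred J) (h : J -> rca D) u :
  std_act (\sum_(j | P j) h j) u = \sum_(j | P j) std_act (h j) u.
Proof.
exact: (big_morph (fun h => std_act h u) (fun h k => std_actD h k u) (std_act0 u)).
Qed.

Lemma std_tens_act h w : std_tens D tau h w = std_act h (std_in D tau w).
Proof. by rewrite std_actE mulr1. Qed.

(** A submodule stable under the generators of the algebra is stable under
    the algebra, and M is generated by the copy of tau. *)
Lemma std_generated (U : submodClosed M) :
  (forall w, std_in D tau w \in U) ->
  (forall x u, u \in U -> std_act (X x) u \in U) ->
  (forall xi u, u \in U -> std_act (V xi) u \in U) ->
  (forall g u, u \in U -> std_act (G g) u \in U) -> forall u, u \in U.
Proof.
move=> Uin UX UV UG.
have Uact h u : u \in U -> std_act h u \in U.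
  move=> uU; move: h; apply: rca_ind => [|a h k hU kU||x h hU|xi h hU|g h hU].
  - by rewrite std_act0 rpred0.
  - by rewrite std_actP; exact: submodP hU kU.
  - by rewrite std_act1.
  - by rewrite std_actM UX.
  - by rewrite std_actM UV.
  - by rewrite std_actM UG.
apply: std_ind; first exact: rpred0.
  by move=> a u v; exact: submodP.
by move=> h w; rewrite std_tens_act; exact: Uact.
Qed.

Lemma std_vec_in xi w : std_act (V xi) (std_in D tau w) = 0.
Proof.
rewrite std_actE mulr1 /std_tens -[V xi]mul1r.
exact/qpi_eq0/StdVec.
Qed.

Lemma std_grp_in g w : std_act (G g) (std_in D tau w) = std_in D tau (irr_act tau g w).
Proof.
rewrite std_actE mulr1 -[G g]mul1r /std_in /std_tens; apply/qpi_eq/mem_lspan.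
exact: StdGrp.
Qed.

Lemma std_in_linear : linear (std_in D tau).
Proof. exact: std_tensPr. Qed.
HB.instance Definition _ :=
  GRing.isLinear.Build (Cx R) tau M _ (std_in D tau) std_in_linear.

Lemma std_deg_in w : std_in D tau w \in std_deg D tau 0.
Proof.
by apply: mem_lspan; exists [tuple], w; rewrite big_ord0 std_act1.
Qed.

Lemma std_deg_X (k : nat) x u :
  u \in std_deg D tau k -> std_act (X x) u \in std_deg D tau k.+1.
Proof.
move: u; apply: lspan_ind.
- by rewrite linear0 rpred0.
- by move=> a u v; exact: linear_step_in.
move=> _ [y [w ->]]; apply: mem_lspan; exists [tuple of x :: y], w.
rewrite (prod_tuple_cons X); exact/esym/std_actM.
Qed.

Lemma std_deg_ind0 (Q : M -> Prop) :
  Q 0 -> (forall a u v, Q u -> Q v -> Q (a *: u + v)) ->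
  (forall w, Q (std_in D tau w)) -> forall u, u \in std_deg D tau 0 -> Q u.
Proof.
move=> Q0 QD Qin; apply: lspan_ind => // _ [y [w ->]].
by rewrite big_ord0 std_act1; exact: Qin.
Qed.

Lemma std_deg_indS (k : nat) (Q : M -> Prop) :
  Q 0 -> (forall a u v, Q u -> Q v -> Q (a *: u + v)) ->
  (forall x u, u \in std_deg D tau k -> Q (std_act (X x) u)) ->
  forall u, u \in std_deg D tau k.+1 -> Q u.
Proof.
move=> Q0 QD QX; apply: lspan_ind => // _ [y [w ->]].
case/tupleP: y => x y; rewrite (prod_tuple_cons X) std_actM.
by apply: QX; apply: mem_lspan; exists y, w.
Qed.

Lemma std_grp_cov g x u :
  std_act (G g) (std_act (X x) u)
  = std_act (X (dual_action (rho D) g x)) (std_act (G g) u).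
Proof.
apply: etrans (esym (std_actM (G g) (X x) u)) _; rewrite rca_grp_cov.
exact: std_actM.
Qed.

Lemma std_vec_cov xi x u : std_act (V xi) (std_act (X x) u)
  = std_act (X x) (std_act (V xi) u) + (toCx (x xi) *: u
    - \sum_(s in reflections (rho D))
        (toCx (x (alpha D s) * coroot D s xi) * cpar D s) *: std_act (G s) u).
Proof.
set c := toCx (x xi); set S := \sum_(s in _) _.
have e1 : std_act (c *: (1 : rca D)) u = c *: u by rewrite std_actZ std_act1.
have e2 : std_act (\sum_(s in reflections (rho D))
    (toCx (x (alpha D s) * coroot D s xi) * cpar D s) *: G s) u = S.
  by rewrite std_act_sum; apply: eq_bigr => s _; exact: std_actZ.
apply: etrans (esym (std_actM (V xi) (X x) u)) _; rewrite rca_vec_cov.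
apply: etrans (std_actD _ _ u) _; apply: congr2 (std_actM _ _ _) _.
apply: etrans (std_actD _ _ u) _; apply: congr2 e1 _.
exact: etrans (std_actN _ _) (congr1 -%R e2).
Qed.

Lemma std_deg_V0 xi u : u \in std_deg D tau 0 -> std_act (V xi) u = 0.
Proof. exact: (deg_V0 std_deg_ind0 std_vec_in). Qed.

Lemma std_deg_V (k : nat) xi u :
  u \in std_deg D tau k.+1 -> std_act (V xi) u \in std_deg D tau k.
Proof.
exact: (deg_V std_deg_in std_deg_X std_deg_ind0 std_deg_indS
  std_grp_in std_grp_cov std_vec_in std_vec_cov).
Qed.

Lemma std_deg_generate u : u \in lspan [set v | exists k : nat, v \in std_deg D tau k].
Proof.
exact: (deg_generate std_deg_in std_deg_X std_deg_ind0 std_deg_indS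
  std_grp_in std_grp_cov std_vec_in std_vec_cov std_generated).
Qed.

End StdTheory.

(** * The action of u(1,1) on the standard module *)

Section StdShift.
Context {R : realType} {E : vectType R} {gT : finGroupType}.
Context {D : reflection_datum E gT} {tau : irrep (Cx R) gT}.
Local Notation M := (std D tau).
Local Notation deg := (std_deg D tau).

(** Closed under linear combinations and composition, so the degrees of
    E_+, E_-, Z_0 follow from those of the generators. *)
Definition shifts (k k' : nat) (h : rca D) : Prop :=
  forall u : M, u \in deg k -> std_act h u \in deg k'.
Definition kills (k : nat) (h : rca D) : Prop :=
  forall u : M, u \in deg k -> std_act h u = 0.

Lemma shiftsZ k k' a h : shifts k k' h -> shifts k k' (a *: h).
Proof. by move=> hk u uk; rewrite std_actZ; apply/rpredZ/hk. Qed.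
Lemma shiftsN k k' h : shifts k k' h -> shifts k k' (- h).
Proof. by move=> hk u uk; rewrite std_actN -scaleN1r; apply/rpredZ/hk. Qed.
Lemma shiftsD k k' h h' : shifts k k' h -> shifts k k' h' -> shifts k k' (h + h').
Proof.
by move=> hk hk' u uk; rewrite std_actD; apply: rpredD; [exact: hk|exact: hk'].
Qed.
Lemma shifts_sum k k' (J : finType) (h : J -> rca D) :
  (forall j, shifts k k' (h j)) -> shifts k k' (\sum_j h j).
Proof. by move=> hk u uk; rewrite std_act_sum; apply: rpred_sum => j _; exact: hk. Qed.
Lemma shiftsM k k' k'' h h' : shifts k k' h' -> shifts k' k'' h -> shifts k k'' (h * h').
Proof. by move=> hk hk' u uk; rewrite std_actM; exact/hk'/hk. Qed.

Lemma killsZ k a h : kills k h -> kills k (a *: h).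
Proof. by move=> hk u uk; rewrite std_actZ (hk _ uk) scaler0. Qed.
Lemma killsN k h : kills k h -> kills k (- h).
Proof. by move=> hk u uk; rewrite std_actN (hk _ uk) oppr0. Qed.
Lemma killsD k h h' : kills k h -> kills k h' -> kills k (h + h').
Proof. by move=> hk hk' u uk; rewrite std_actD (hk _ uk) (hk' _ uk) addr0. Qed.
Lemma kills_sum k (J : finType) (h : J -> rca D) :
  (forall j, kills k (h j)) -> kills k (\sum_j h j).
Proof. by move=> hk u uk; rewrite std_act_sum; apply: big1 => j _; exact: hk. Qed.
Lemma killsM k k' h h' : shifts k k' h' -> kills k' h -> kills k (h * h').
Proof. by move=> hk hk' u uk; rewrite std_actM; exact/hk'/hk. Qed.
Lemma killsMr k h h' : kills k h' -> kills k (h * h').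
Proof. by move=> hk u uk; rewrite std_actM (hk _ uk) linear0. Qed.

Lemma shifts_cov k x : shifts k k.+1 (rca_cov D x).
Proof. exact: std_deg_X. Qed.
Lemma shifts_vec k xi : shifts k.+1 k (rca_vec D xi).
Proof. exact: std_deg_V. Qed.
Lemma kills_vec xi : kills 0 (rca_vec D xi).
Proof. exact: std_deg_V0. Qed.

Context {n : nat} (B : complex_frame D n).

Lemma shifts_Ep k : shifts k k.+2 (rca_Ep B).
Proof.
apply/shiftsZ/shifts_sum => j.
by apply: shiftsD; apply: shiftsM; exact: shifts_cov.
Qed.

Lemma shifts_Em k : shifts k.+2 k (rca_Em B).
Proof.
apply/shiftsN/shiftsZ/shifts_sum => j.
by apply: shiftsD; apply: shiftsM; exact: shifts_vec.
Qed.

Lemma kills_Em k : (k < 2)%N -> kills k (rca_Em B).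
Proof.
case: k => [|[|//]] _; apply/killsN/killsZ/kills_sum => j; apply: killsD.
- exact/killsMr/kills_vec.
- exact/killsMr/kills_vec.
- by apply: killsM (kills_vec _); exact: shifts_vec.
- by apply: killsM (kills_vec _); exact: shifts_vec.
Qed.

Lemma shifts_Z0 k : shifts k k (rca_Z0 B).
Proof.
have cv x xi : shifts k k (rca_cov D x * rca_vec D xi).
  case: k => [|k].
    by move=> u u0; rewrite std_actM std_deg_V0// linear0 rpred0.
  by apply: (shiftsM (k' := k)); [exact: shifts_vec | exact: shifts_cov].
apply/shiftsZ/shifts_sum => j.
by apply: shiftsD; [|apply: shiftsN]; exact: cv.
Qed.

Hypothesis dimE : \dim {:E} = (2 * n)%N.

Lemma std_deg_finitely_spanned k : finitely_spanned (deg k).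
Proof.
have Xd x (u : M) : std_act (rca_cov D x) u
    = \sum_a toCx (x (frame_vec B a)) *: std_act (rca_cov D (frame_cov B a)) u.
  rewrite {1}(frame_cov_decomp B dimE x) rca_cov_sum std_act_sum.
  by apply: eq_bigr => a _; exact: std_actZ.
have ts (v : tau) : v \in lspan [set w | w \in (vbasis {:tau} : seq tau)].
  rewrite (coord_vbasis (memvf v)); apply: rpred_sum => i _; apply: rpredZ.
  by apply: mem_lspan; apply: mem_nth; rewrite size_tuple.
exact: (deg_finitely_spanned std_deg_in std_deg_X std_deg_ind0 std_deg_indS Xd ts).
Qed.

Variable N : Cx R.
Hypothesis hN : forall v : tau,
  \sum_(s in reflections (rho D)) cpar D s *: irr_act tau s v = N *: v.

(** The Euler part of H ends in vectors, which kill the copy of tau; what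
    remains is n minus the sum of reflections. *)
Lemma std_H_in w :
  std_act (rca_H B) (std_in D tau w) = (0%:R + n%:R - N) *: std_in D tau w.
Proof.
set u := std_in D tau w.
have e1 : std_act (\sum_j (rca_cov D (xx B j) * rca_vec D (vxi B j)
    + rca_cov D (yy B j) * rca_vec D (veta B j))) u = 0.
  have := @kills_sum 0 _ (fun j => rca_cov D (xx B j) * rca_vec D (vxi B j)
    + rca_cov D (yy B j) * rca_vec D (veta B j)).
  apply; last exact: std_deg_in.
  by move=> j; apply: killsD; apply/killsMr/kills_vec.
have e2 : std_act (n%:R : rca D) u = n%:R *: u.
  by rewrite -(scaler_nat n (1 : rca D)) std_actZ std_act1.
have e3 : std_act (rca_refl_sum (D := D)) u = N *: u.
  apply: etrans (std_act_sum _ _ u) (etrans _ (linear_comb_eq (std_in D tau) (hN w))).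
  by apply: eq_bigr => s _; apply: etrans (std_actZ _ _ u) (congr1 _ (std_grp_in s w)).
apply: etrans (std_actD _ _ u) _.
apply: etrans (congr2 +%R (std_actD _ _ u) (std_actN _ u)) _.
by rewrite e1 e2 e3 add0r add0r scalerBl.
Qed.

Lemma std_H_deg k u : u \in deg k -> std_act (rca_H B) u = (k%:R + n%:R - N) *: u.
Proof.
have HX x (v : M) : std_act (rca_H B) (std_act (rca_cov D x) v)
    = std_act (rca_cov D x) (std_act (rca_H B) v) + std_act (rca_cov D x) v.
  apply: etrans (esym (std_actM _ _ v)) _; rewrite (rca_H_cov B dimE).
  by apply: etrans (std_actD _ _ v) _; apply: congr2 (std_actM _ _ v) _.
apply: (deg_weight std_deg_ind0 std_deg_indS
  (mu := fun k => k%:R + n%:R - N) _ std_H_in HX).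
by move=> m; rewrite -natr1 (addrAC m%:R) [LHS]addrAC.
Qed.

Lemma std_act_comm (h k l : rca D) : h * k - k * h = l ->
  forall u : M, std_act h (std_act k u) - std_act k (std_act h u) = std_act l u.
Proof.
move=> <- u; apply/esym; apply: etrans (std_actD _ _ u) _.
apply: congr2 (std_actM _ _ u) _; apply: etrans (std_actN _ u) _.
exact (congr1 (fun v => - v) (std_actM k h u)).
Qed.

Lemma std_act_commute (h k : rca D) : h * k = k * h ->
  forall u : M, std_act h (std_act k u) = std_act k (std_act h u).
Proof. by move=> hk u; rewrite -(std_actM h k u) hk std_actM. Qed.

Variable star : rca D -> rca D.
Hypothesis starP : is_rca_star B star.

Let Ep : {linear M -> M} := std_act (rca_Ep B).
Let Em : {linear M -> M} := std_act (rca_Em B).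
Let H : {linear M -> M} := std_act (rca_H B).
Let Z : {linear M -> M} := std_act (rca_Z0 B).

Lemma std_HEp u : H (Ep u) - Ep (H u) = 2 *: Ep u.
Proof.
rewrite (std_act_comm (rca_H_Ep B dimE)) -(scaler_nat 2 (rca_Ep B)).
exact: std_actZ.
Qed.

Lemma std_HEm u : H (Em u) - Em (H u) = - 2 *: Em u.
Proof.
rewrite (std_act_comm (rca_H_Em dimE starP)) -(scaler_nat 2 (rca_Em B)) -scaleNr.
exact: std_actZ.
Qed.

Lemma std_EpEm u : Ep (Em u) - Em (Ep u) = H u.
Proof. exact: std_act_comm (rca_EpEm B dimE) u. Qed.
Lemma std_ZEp u : Z (Ep u) = Ep (Z u).
Proof. exact: std_act_commute (rca_Z0_Ep B dimE) u. Qed.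
Lemma std_ZEm u : Z (Em u) = Em (Z u).
Proof. exact: std_act_commute (rca_Z0_Em dimE starP) u. Qed.
Lemma std_ZH u : Z (H u) = H (Z u).
Proof. exact: std_act_commute (rca_Z0_H dimE starP) u. Qed.

Definition std_u11 : u11_module (Cx R) :=
  @U11Module (Cx R) M Ep Em H Z std_HEp std_HEm std_EpEm std_ZEp std_ZEm std_ZH.

End StdShift.

(** * The decomposition of the standard module *)

Theorem corollary3p9
  (R : realType) (n : nat) (E : vectType R) (hE : \dim {:E} = (2 * n)%N)
  (gT : finGroupType) (D : reflection_datum E gT) (B : complex_frame D n)
  (tau : irrep (Cx R) gT)
  (hc : forall s : gT, s \in reflections (rho D) -> cpar D s \is Num.real)
  (N : Cx R)
  (hN : forall v : tau,
      \sum_(s in reflections (rho D)) cpar D s *: irr_act tau s v = N *: v)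
  (star : rca D -> rca D) (hstar : is_rca_star B star)
  (hirr : std_irreducible D tau)
  (hunit : unitarisable D tau star) :
  (* V preserves each eigenspace H_c(tau)_(k, lambda) ... *)
  (forall (k : nat) (l : Cx R) (h : rca D) (p : std D tau),
      centralises_u11 B h -> p \in harmonic_eig B tau k l ->
      std_act h p \in harmonic_eig B tau k l)
  /\
  (* ... and M_c(tau) is isomorphic to the direct sum of the tensor products. *)
  exists Phi : {linear joint_sum B tau N -> std D tau},
    [/\ bijective Phi,
        (forall (k : nat) (l : {l | l \in spectrum B tau k})
                (h : rca D) (p q : subspace (harmonic_eig B tau k (val l)))
                (v : L_u11 (k%:R + n%:R - N) (val l)),
            centralises_u11 B h -> val q = std_act h (val p) ->
            Phi (joint_pure B tau N k l q v)
            = std_act h (Phi (joint_pure B tau N k l p v)))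
      & (forall (k : nat) (l : {l | l \in spectrum B tau k})
                (p : subspace (harmonic_eig B tau k (val l)))
                (v : L_u11 (k%:R + n%:R - N) (val l)),
          let L := L_u11 (k%:R + n%:R - N) (val l) in
          [/\ Phi (joint_pure B tau N k l p (u11_Ep L v))
              = std_act (rca_Ep B) (Phi (joint_pure B tau N k l p v)),
              Phi (joint_pure B tau N k l p (u11_Em L v))
              = std_act (rca_Em B) (Phi (joint_pure B tau N k l p v)),
              Phi (joint_pure B tau N k l p (u11_H L v))
              = std_act (rca_H B) (Phi (joint_pure B tau N k l p v))
            & Phi (joint_pure B tau N k l p (u11_Z L v))
              = std_act (rca_Z0 B) (Phi (joint_pure B tau N k l p v))])].

Proof.
case: hunit => beta [contra _ _] beta_pos.
pose M := std D tau.
pose Ep : {linear M -> M} := std_act (rca_Ep B).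
pose Em : {linear M -> M} := std_act (rca_Em B).
pose H : {linear M -> M} := std_act (rca_H B).
pose Z : {linear M -> M} := std_act (rca_Z0 B).
pose deg k : submodClosed M := std_deg D tau k.
pose mu k : Cx R := k%:R + n%:R - N.
pose P k l : submodClosed M := harmonic_eig B tau k l.
have Ep_adj (u v : M) : beta (Ep u) v = - beta u (Em v).
  apply: etrans (contra _ u v) _; rewrite (star_Ep hstar).
  by rewrite (std_actN (rca_Em B) v) linearNr.
have Em_adj (u v : M) : beta (Em u) v = - beta u (Ep v).
  apply: etrans (contra _ u v) _; rewrite (star_Em hstar).
  by rewrite (std_actN (rca_Ep B) v) linearNr.
have H_adj (u v : M) : beta (H u) v = beta u (H v).
  by apply: etrans (contra _ u v) _; rewrite (star_H hE hstar).
have Z_adj (u v : M) : beta (Z u) v = beta u (Z v).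
  by apply: etrans (contra _ u v) _; rewrite (star_Z0 hstar).
have mu_inj : injective mu.
  by move=> k k' /addIr/addIr/eqP; rewrite eqr_nat => /eqP.
have deg_H k (u : M) : u \in deg k -> H u = mu k *: u.
  exact: std_H_deg.
have PP k l (p : M) : reflect [/\ p \in deg k, Em p = 0 & Z p = l *: p]
    (p \in P k l) by exact: harmonic_eigP.
have spP k l (p : M) : p \in P k l -> p != 0 -> l \in spectrum B tau k.
  move=> /harmonic_eigP[pk p0 pl] pn0; apply/asboolP; exists p => //.
  by split=> //; apply/andP; split=> //; apply/eqP.
split=> [k l h p [_ hEm hH hZ]|].
  exact: (P_preserved (M := std_u11 (tau := tau) hE hstar) mu_inj deg_H
    (@std_deg_generate _ _ _ D tau) PP (T := std_act h)
    (std_act_commute hEm) (std_act_commute hH) (std_act_commute hZ)).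
have := joint_decomposition (M := std_u11 (tau := tau) hE hstar)
  beta_pos Ep_adj Em_adj H_adj Z_adj mu_inj deg_H (@std_deg_generate _ _ _ D tau)
  (std_deg_finitely_spanned B hE) (fun k => @shifts_Ep _ _ _ D tau n B k)
  (fun k => @shifts_Em _ _ _ D tau n B k) (fun k u hk => @kills_Em _ _ _ D tau n B k hk u)
  (fun k => @shifts_Z0 _ _ _ D tau n B k) PP spP.
(* both direct sums unfold to the same module *)
unfold joint_tens, isotypic_sum, isotypic, P, mu, std_u11.
cbn [u11_sort u11_Ep u11_Em u11_H u11_Z].
move=> [Phi [Phi_bij PhiV PhiU]].
unfold joint_pure, joint_sum, joint_summand.
exists Phi; split.
- exact Phi_bij.
- move=> k l h p q v [hEp _ _ _] qE.
  exact (PhiV k l (std_act h) p q v (std_act_commute hEp) qE).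
- exact PhiU.
Qed.
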